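(* Let $H$ and $a$ satisfy the standing assumptions in the context, let $w\in C(\mathbb{T}^n)$ be any viscosity solution of $H(x,Dw)=a(x)\Delta w$ in $\mathbb{T}^n$, and for $\eta>0$ let $w^\eta(x):=\int_{\mathbb{R}^n}\gamma^\eta(y)w(x+y)\,dy$ be its mollification. Let $C>0$ and the functions $S^\eta$ ($\eta>0$) be as in the context. For $\varepsilon,\eta>0$ and $x_0\in\mathbb{T}^n$ let $u^{\varepsilon,\eta}$ be the solution of $$\varepsilon u^{\varepsilon,\eta}+H(x,Du^{\varepsilon,\eta})=(a(x)+\eta^2)\Delta u^{\varepsilon,\eta}\quad\text{in }\mathbb{T}^n,$$ and let $\theta^{\varepsilon,\eta}$ be the solution of $$\varepsilon\theta^{\varepsilon,\eta}-\operatorname{div}(D_pH(x,Du^{\varepsilon,\eta})\theta^{\varepsilon,\eta})=\Delta(a(x)\theta^{\varepsilon,\eta})+\eta^2\Delta\theta^{\varepsilon,\eta}+\varepsilon\delta_{x_0}\quad\text{in }\mathbb{T}^n .$$ Then $$u^{\varepsilon,\eta}(x_0)\ge w^\eta(x_0)-\int_{\mathbb{T}^n}w^\eta\theta^{\varepsilon,\eta}\,dx-\frac{C\eta}{\varepsilon}-\frac1\varepsilon\int_{\mathbb{T}^n}S^\eta\theta^{\varepsilon,\eta}\,dx .$$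
   Context: $\mathbb{T}^n=\mathbb{R}^n/\mathbb{Z}^n$; functions on $\mathbb{T}^n$ are identified with $\mathbb{Z}^n$-periodic functions on $\mathbb{R}^n$. Standing assumptions: $H\in C^2(\mathbb{T}^n\times\mathbb{R}^n)$ is real-valued, $p\mapsto H(x,p)$ is convex for each $x\in\mathbb{T}^n$, there is a constant $C_H>0$ with $|D_xH(x,p)|\le C_H(1+H(x,p))$ for all $(x,p)\in\mathbb{T}^n\times\mathbb{R}^n$, and $\lim_{|p|\to+\infty}H(x,p)/|p|=+\infty$ uniformly for $x\in\mathbb{T}^n$; $a\in C^2(\mathbb{T}^n)$ and $a\ge0$ in $\mathbb{T}^n$. Mollifier: $\gamma\in C_c^\infty(\mathbb{R}^n)$, $\gamma\ge0$, $\operatorname{supp}\gamma\subset\overline{B}(0,1)$, $\|\gamma\|_{L^1(\mathbb{R}^n)}=1$, and $\gamma^\eta(y):=\eta^{-n}\gamma(\eta^{-1}y)$. The constant $C>0$ (independent of $\eta$ and $\varepsilon$) and the continuous functions $S^\eta:\mathbb{T}^n\to\mathbb{R}$ are those associated with $w$ having the following properties (such $C$ and $S^\eta$ exist): $|S^\eta(x)|\le C$ and $\lim_{\eta\to0}S^\eta(x)=0$ for each $x\in\mathbb{T}^n$; $H(x,Dw^\eta)\le a(x)\Delta w^\eta+S^\eta(x)$ in $\mathbb{T}^n$; and $|\eta^2\Delta w^\eta|\le C\eta$. The function $u^{\varepsilon,\eta}$ is a classical solution. The adjoint equation for $\theta^{\varepsilon,\eta}$ is understood in the distributional sense, $\delta_{x_0}$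 is the Dirac measure at $x_0$, and $\theta^{\varepsilon,\eta}>0$ in $\mathbb{T}^n\setminus\{x_0\}$ with $\int_{\mathbb{T}^n}\theta^{\varepsilon,\eta}\,dx=1$. *)

(* Defs.v *)
From HB Require Import structures.
From mathcomp Require Import all_boot all_order all_algebra.
From mathcomp Require Import all_classical all_reals all_analysis measurable_realfun.

Set Implicit Arguments.
Unset Strict Implicit.
Unset Printing Implicit Defensive.

Import Order.TTheory GRing.Theory Num.Theory.
Import numFieldNormedType.Exports.

Local Open Scope classical_set_scope.
Local Open Scope ring_scope.

(* The library has Lebesgue measure on the line only.  Lebesgue measure on
   [n.-tuple R] is the iterated product measure, transported along
   [(x, t) |-> x :: t]; it starts from the unit mass at the empty tuple. *)
Section LebesgueCons.
Context {R : realType} {n : nat}.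
Variable mu : {sigma_finite_measure set (n.-tuple R) -> \bar R}.

Definition tcons (z : measurableTypeR R * n.-tuple R) : n.+1.-tuple R :=
  [the n.+1.-tuple R of z.1 :: z.2].

Lemma measurable_tcons : measurable_fun [set: measurableTypeR R * n.-tuple R] tcons.
Proof. exact: measurable_cons. Qed.

Definition lebesgue_cons : set (n.+1.-tuple R) -> \bar R :=
  pushforward (@lebesgue_measure R \x mu)%E tcons.

Let lebesgue_cons0 : lebesgue_cons set0 = 0%E.
Proof. by rewrite /lebesgue_cons /pushforward preimage_set0 measure0. Qed.

Let lebesgue_cons_ge0 A : (0 <= lebesgue_cons A)%E.
Proof. by rewrite /lebesgue_cons /pushforward; apply: measure_ge0. Qed.

Let lebesgue_cons_sigma_additive : semi_sigma_additive lebesgue_cons.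
Proof.
move=> F mF tF mUF; rewrite /lebesgue_cons /pushforward preimage_bigcup.
apply: measure_semi_sigma_additive.
- by move=> k; rewrite -[X in measurable X]setTI; exact: measurable_tcons.
- apply/trivIsetP => /= i j _ _ ij; rewrite -preimage_setI.
  by move/trivIsetP : tF => /(_ _ _ _ _ ij) ->//; rewrite preimage_set0.
- by rewrite -preimage_bigcup -[X in measurable X]setTI; exact: measurable_tcons.
Qed.

HB.instance Definition _ := isMeasure.Build _ _ _ lebesgue_cons
  lebesgue_cons0 lebesgue_cons_ge0 lebesgue_cons_sigma_additive.

Let lebesgue_cons_sigma_finite : sigma_finite setT lebesgue_cons.
Proof.
have /sigma_finiteP[F [TF ndF Foo]] := sigma_finiteT (@lebesgue_measure R).
have /sigma_finiteP[G [TG ndG Goo]] := sigma_finiteT mu.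
pose g (t : n.+1.-tuple R) := (thead t, [tuple of behead t]).
have mg : measurable_fun setT g.
  apply/measurable_fun_pair; first exact: measurable_tnth.
  exact: measurable_behead.
exists (fun k => g @^-1` (F k `*` G k)).
  apply/esym; rewrite -subTset => t _.
  have [i _ Fi] : (\bigcup_k F k) (g t).1 by rewrite -TF.
  have [j _ Gj] : (\bigcup_k G k) (g t).2 by rewrite -TG.
  exists (maxn i j) => //; split.
    by move: Fi; exact/subsetPset/ndF/leq_maxl.
  by move: Gj; exact/subsetPset/ndG/leq_maxr.
move=> k; have [mF Foo'] := Foo k; have [mG Goo'] := Goo k; split.
  by rewrite -[X in measurable X]setTI; apply: mg => //; exact: measurableX.
rewrite /lebesgue_cons /pushforward.
rewrite (_ : tcons @^-1` (g @^-1` (F k `*` G k)) = F k `*` G k).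
  by rewrite product_measure1E// lte_mul_pinfty// ge0_fin_numE.
rewrite -comp_preimage (_ : g \o tcons = id)//.
by apply/funext => -[x t]; congr pair; apply/val_inj.
Qed.

HB.instance Definition _ := Measure_isSigmaFinite.Build _ _ _ lebesgue_cons
  lebesgue_cons_sigma_finite.

End LebesgueCons.

Fixpoint lebesgue_tuple {R : realType} (n : nat) :
    {sigma_finite_measure set (n.-tuple R) -> \bar R} :=
  match n with
  | 0 => dirac [tuple]
  | m.+1 => lebesgue_cons (@lebesgue_tuple R m)
  end.

Definition row_of_tuple {R : realType} {n : nat}
  (t : n.-tuple R) : 'rV[R]_n := \row_i tnth t i.

Definition space_integral {R : realType} {n : nat} (f : 'rV[R]_n -> R) : R :=
  \int[lebesgue_tuple n]_t f (row_of_tuple t).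

(* Functions on the torus are periodic functions on the whole space, and
   integrals over the torus are integrals over the unit cube. *)
Definition unit_cube {R : realType} {n : nat} :
    set (n.-tuple R) :=
  [set t | forall i, 0 <= tnth t i < 1].

Definition torus_integral {R : realType} {n : nat} (f : 'rV[R]_n -> R) : R :=
  \int[lebesgue_tuple n]_(t in unit_cube) f (row_of_tuple t).

Definition torus_integrable {R : realType} {n : nat} (f : 'rV[R]_n -> R) : Prop :=
  (lebesgue_tuple n).-integrable unit_cube (fun t => (f (row_of_tuple t))%:E).

Definition Zperiodic {R : realType} {n : nat} (f : 'rV[R]_n -> R) : Prop :=
  forall (k : 'rV[int]_n) (x : 'rV[R]_n), f (x + map_mx intr k) = f x.

Definition torus_eq {R : realType} {n : nat} (x y : 'rV[R]_n) : Prop :=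
  exists k : 'rV[int]_n, y = x + map_mx intr k.

(* The library norm on ['rV[R]_n] is the sup norm. *)
Definition enorm {R : realType} {n : nat} (p : 'rV[R]_n) : R :=
  Num.sqrt (\sum_i p 0 i ^+ 2).

Definition dot {R : realType} {n : nat} (p q : 'rV[R]_n) : R :=
  \sum_i p 0 i * q 0 i.

Definition partial {R : realType} {n : nat} (i : 'I_n) (f : 'rV[R]_n -> R)
  (x : 'rV[R]_n) : R := 'D_(delta_mx 0 i) f x.

Definition grad {R : realType} {n : nat} (f : 'rV[R]_n -> R) (x : 'rV[R]_n) :
  'rV[R]_n := \row_i partial i f x.

Definition laplacian {R : realType} {n : nat} (f : 'rV[R]_n -> R)
  (x : 'rV[R]_n) : R := \sum_i partial i (partial i f) x.

Fixpoint Ck {R : realType} {n : nat} (k : nat) (f : 'rV[R]_n -> R) : Prop :=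
  match k with
  | 0 => continuous f
  | m.+1 => continuous f /\ forall i : 'I_n,
      (forall x, derivable f x (delta_mx 0 i)) /\ Ck m (partial i f)
  end.

Definition Cinfty {R : realType} {n : nat} (f : 'rV[R]_n -> R) : Prop :=
  forall k, Ck k f.

Definition hamiltonian {R : realType} {n : nat}
    (H : 'rV[R]_n -> 'rV[R]_n -> R) : Prop :=
  [/\ (forall p, Zperiodic (H ^~ p)) /\
        Ck 2 (fun z : 'rV[R]_(n + n) => H (lsubmx z) (rsubmx z)),
      forall x, convex_function [set: convex_lmodType 'rV[R]_n] (H x),
      exists2 CH : R, 0 < CH &
        forall x p, enorm (grad (H ^~ p) x) <= CH * (1 + H x p) &
      forall M : R, \forall r \near +oo,
        forall x p, r <= enorm p -> M <= H x p / enorm p].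

Definition diffusion {R : realType} {n : nat} (a : 'rV[R]_n -> R) : Prop :=
  [/\ Zperiodic a, Ck 2 a & forall x, 0 <= a x].

Definition viscosity_subsolution {R : realType} {n : nat}
    (H : 'rV[R]_n -> 'rV[R]_n -> R) (a w : 'rV[R]_n -> R) : Prop :=
  forall (phi : 'rV[R]_n -> R) x, Zperiodic phi -> Ck 2 phi ->
    (\forall y \near x, w y - phi y <= w x - phi x) ->
    H x (grad phi x) <= a x * laplacian phi x.

Definition viscosity_supersolution {R : realType} {n : nat}
    (H : 'rV[R]_n -> 'rV[R]_n -> R) (a w : 'rV[R]_n -> R) : Prop :=
  forall (phi : 'rV[R]_n -> R) x, Zperiodic phi -> Ck 2 phi ->
    (\forall y \near x, w x - phi x <= w y - phi y) ->
    a x * laplacian phi x <= H x (grad phi x).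

Definition viscosity_solution {R : realType} {n : nat}
    (H : 'rV[R]_n -> 'rV[R]_n -> R) (a w : 'rV[R]_n -> R) : Prop :=
  [/\ Zperiodic w, continuous w,
      viscosity_subsolution H a w & viscosity_supersolution H a w].

Definition mollifier {R : realType} {n : nat} (gamma : 'rV[R]_n -> R) : Prop :=
  [/\ Cinfty gamma, forall y, 0 <= gamma y,
      closure [set y | gamma y != 0] `<=` [set y | enorm y <= 1] &
      (\int[lebesgue_tuple n]_t `|gamma (row_of_tuple t)|%:E = 1)%E].

Definition rescale {R : realType} {n : nat} (gamma : 'rV[R]_n -> R) (eta : R)
  (y : 'rV[R]_n) : R := eta ^- n * gamma (eta^-1 *: y).

Definition mollify {R : realType} {n : nat} (gamma : 'rV[R]_n -> R) (eta : R)
    (w : 'rV[R]_n -> R) (x : 'rV[R]_n) : R :=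
  space_integral (fun y => rescale gamma eta y * w (x + y)).

Definition mollification_bounds {R : realType} {n : nat}
    (H : 'rV[R]_n -> 'rV[R]_n -> R) (a : 'rV[R]_n -> R)
    (weta : R -> 'rV[R]_n -> R) (C : R) (S : R -> 'rV[R]_n -> R) : Prop :=
  [/\ forall eta : R, 0 < eta -> Zperiodic (S eta) /\ continuous (S eta),
      forall (eta : R) x, 0 < eta -> `|S eta x| <= C,
      forall x, S eta x @[eta --> (0 : R)^'+] --> (0 : R),
      forall (eta : R) x, 0 < eta ->
        H x (grad (weta eta) x) <= a x * laplacian (weta eta) x + S eta x &
      forall (eta : R) x, 0 < eta ->
        `|eta ^+ 2 * laplacian (weta eta) x| <= C * eta].

Definition discounted_solution {R : realType} {n : nat}
    (H : 'rV[R]_n -> 'rV[R]_n -> R) (a : 'rV[R]_n -> R) (eps eta : R)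
    (u : 'rV[R]_n -> R) : Prop :=
  [/\ Zperiodic u, Ck 2 u & forall x,
      eps * u x + H x (grad u x) = (a x + eta ^+ 2) * laplacian u x].

(* Distributional form: all derivatives are moved onto the test function. *)
Definition adjoint_equation {R : realType} {n : nat}
    (H : 'rV[R]_n -> 'rV[R]_n -> R) (a : 'rV[R]_n -> R) (eps eta : R)
    (x0 : 'rV[R]_n) (u theta : 'rV[R]_n -> R) : Prop :=
  forall phi : 'rV[R]_n -> R, Zperiodic phi -> Cinfty phi ->
    eps * torus_integral (fun x => theta x * phi x) +
    torus_integral (fun x =>
      dot (theta x *: grad (H x) (grad u x)) (grad phi x)) =
    torus_integral (fun x => a x * theta x * laplacian phi x) +
    eta ^+ 2 * torus_integral (fun x => theta x * laplacian phi x) +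
    eps * phi x0.

(* The value of [theta] on the (null) class of [x0] is left free. *)
Definition adjoint_solution {R : realType} {n : nat}
    (H : 'rV[R]_n -> 'rV[R]_n -> R) (a : 'rV[R]_n -> R) (eps eta : R)
    (x0 : 'rV[R]_n) (u theta : 'rV[R]_n -> R) : Prop :=
  [/\ Zperiodic theta /\ torus_integrable theta,
      adjoint_equation H a eps eta x0 u theta,
      forall x, ~ torus_eq x0 x -> 0 < theta x &
      torus_integral theta = 1].

(* Main.v *)
Require Import Defs.
From HB Require Import structures.
From mathcomp Require Import all_boot all_order all_algebra.
From mathcomp Require Import all_classical all_reals all_analysis measurable_realfun.
From mathcomp Require Import ring lra.

Set Implicit Arguments.
Unset Strict Implicit.
Unset Printing Implicit Defensive.

Import Order.TTheory GRing.Theory Num.Theory.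
Import numFieldNormedType.Exports.

Local Open Scope classical_set_scope.
Local Open Scope ring_scope.

(** Put [F := w^eta - u].  Subtracting the equation of [u] from the
    inequality satisfied by [w^eta], and bounding the difference of the two
    values of [H (x, .)] from below by its tangent at [Du] (convexity), gives
    the pointwise estimate

      eps F + D_pH(x, Du) . DF - (a + eta^2) Lap F
        <= eps w^eta + S^eta + C eta,

    the error [C eta] paying for the term [eta^2 Lap w^eta].  The left-hand
    side is the linearization [linearized H a eps eta u F] of the equation of
    [u], and the adjoint equation says exactly that integrating it against
    [theta] yields [eps F (x0)].  As [theta] is positive almost everywhere and
    has mass one, integrating the estimate against [theta] and dividing by
    [eps] is the claim.

    The adjoint equation is only known against smooth test functions while [u],
    hence [F], is only of class C^2.  The linearized operator involves
    derivatives of order at most two, so it suffices to approximate [F],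
    boundedly and pointwise together with its first and pure second partial
    derivatives, by smooth periodic functions
    ([smooth_periodic_approximation]), and to pass to the limit by dominated
    convergence ([adjoint_C2]).  The approximations are moving averages
    [correlate K F] with ever more concentrated kernels [K] rescaled from
    [gamma]; [w^eta] is such an average too, and it is smooth for the same
    reason.

    Both facts rest on differentiation under the integral sign.  The derivative
    of a moving average can be put on the averaged function
    ([correlate_derive], which gives convergence of the derivatives) or, after
    a translation of the integration variable, on the kernel
    ([correlate_derive_kernel], which gives smoothness).  The second form needs
    the translation invariance of the iterated product measure
    [lebesgue_tuple] ([lebesgue_tuple_translate]).

    Derivatives are only ever taken along coordinate axes, so total
    differentiability is avoided; in particular the tangent inequality
    [convex_above_tangent] is derived for a convex function from the existence
    of its partial derivatives at the point of contact. *)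

(** * Continuous functions of a row vector *)

Section RowTopology.
Context {R : realType} {n : nat}.
Implicit Types (x y : 'rV[R]_n) (f g : 'rV[R]_n -> R).

Lemma coord_le_norm x i : `|x 0 i| <= `|x|.
Proof.
by rewrite [leRHS]/Num.norm/= mx_normrE; apply/bigmax_geP; right; exists (0, i).
Qed.

Lemma norm_le_coord x r : 0 <= r -> (forall i, `|x 0 i| <= r) -> `|x| <= r.
Proof.
move=> r0 xr; rewrite [leLHS]/Num.norm/= mx_normrE; apply/bigmax_leP; split => //=.
by move=> [i j] _ /=; rewrite (ord1 i).
Qed.

Lemma norm_le_enorm x : `|x| <= enorm x.
Proof.
apply: norm_le_coord => [|i]; first exact: sqrtr_ge0.
rewrite -sqrtr_sqr ler_wsqrtr// (bigD1 i)//= lerDl.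
by apply: sumr_ge0 => j _; exact: sqr_ge0.
Qed.

Lemma continuous_bounded_ball f : continuous f ->
  forall r, exists2 M, 0 <= M & forall x, `|x| <= r -> `|f x| <= M.
Proof.
move=> cf r.
have cA : compact [set x : 'rV[R]_n | `|x| <= r].
  apply: bounded_closed_compact.
    exists r; split; first exact: num_real.
    by move=> s rs x /= /le_trans; apply; exact: ltW.
  rewrite (_ : mkset _ = Num.norm @^-1` [set z : R | z <= r])//.
  apply: closed_comp; last exact: closed_le.
  by move=> x _; exact: norm_continuous.
have : compact (f @` [set x : 'rV[R]_n | `|x| <= r]).
  by apply: continuous_compact => //; exact: continuous_subspaceT.
move=> /compact_bounded[M [_ Mf]].
exists (`|M| + 1); first by rewrite addr_ge0.
by move=> x xr; apply: (Mf (`|M| + 1)); [rewrite ltr_pwDr// ler_norm|exists x].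
Qed.

(** Flooring every coordinate moves a point into the half-open unit cube, which
    reduces periodic functions to a compact set. *)
Lemma exists_unit_translate x :
  exists k : 'rV[int]_n, forall i, 0 <= (x + map_mx intr k) 0 i < 1.
Proof.
exists (\row_i - Num.floor (x 0 i)) => i; rewrite !mxE/= rmorphN/= subr_ge0.
by rewrite floor_le/= ltrBlDl -intrD1 floorD1_gt.
Qed.

Lemma periodic_bounded f : Zperiodic f -> continuous f ->
  exists2 M, 0 <= M & forall x, `|f x| <= M.
Proof.
move=> pf cf; have [M M0 Mf] := continuous_bounded_ball cf 1.
exists M => // x; have [k xk] := exists_unit_translate x.
rewrite -(pf k); apply: Mf; apply: norm_le_coord => // i.
by have /andP[x0 x1] := xk i; rewrite ger0_norm// ltW.
Qed.

(** Reduces continuity of a parametric integral to sequences, the form in which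
    dominated convergence applies. *)
Lemma sequential_continuous f x :
  (forall u : nat -> 'rV[R]_n, u m @[m --> \oo] --> x ->
    f (u m) @[m --> \oo] --> f x) ->
  {for x, continuous f}.
Proof.
move=> seqf; apply: contrapT => nf.
have [e e0 He] : exists2 e : R, 0 < e & forall d, 0 < d ->
    exists y, `|x - y| < d /\ e <= `|f x - f y|.
  apply: contrapT => /forall2NP h; apply: nf.
  apply/(@cvgrPdist_lt _ _ _ _ (nbhs_filter x)) => e e0.
  have [//|/existsNP[d /not_implyP[d0 /forallNP hd]]] := h e.
  near=> y; have /not_andP[xy|/negP] := hd y; last by rewrite -ltNge.
  exfalso; apply: xy; near: y.
  by apply/nbhs_ballP; exists d => //= y; rewrite -ball_normE.
have d0 m : 0 < m.+1%:R^-1 :> R by rewrite invr_gt0.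
(* If continuity fails for [e], choose offending points at distance below
   [1 / (m + 1)]; they converge to [x] but their images do not. *)
pose u m := sval (cid (He _ (d0 m))).
have [ux uf] : (forall m, `|x - u m| < m.+1%:R^-1) /\
    (forall m, e <= `|f x - f (u m)|).
  by split => m; rewrite /u; case: cid => y [].
have /cvgrPdist_lt/(_ e e0)[N _ /(_ N (leqnn N))] : f (u m) @[m --> \oo] --> f x.
  apply: seqf; apply/cvgrPdist_lt => r r0; near=> m.
  apply: lt_trans (ux m) _.
  rewrite -[ltRHS]invrK ltf_pV2 ?posrE ?invr_gt0//.
  by rewrite (@lt_trans _ _ m%:R) ?ltr_nat//; near: m; exact: nbhs_infty_gtr.
by move=> /=; rewrite ltNge uf.
Unshelve. all: by end_near. Qed.

End RowTopology.

Section ContinuousRow.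
Context {R : realType} {n : nat}.
Implicit Types f g : 'rV[R]_n -> R.

Lemma continuous_shift f (x : 'rV[R]_n) : continuous f ->
  continuous (fun y => f (x + y)).
Proof.
move=> cf y.
have h : (fun z => x + z) @ nbhs y --> nbhs (x + y).
  by apply: (cvg_comp2 (cvg_cst _) cvg_id (add_continuous (_, _))).
exact: (cvg_comp _ _ h (cf _)).
Qed.

Lemma continuous_mul f g : continuous f -> continuous g ->
  continuous (fun y : 'rV[R]_n => f y * g y : R).
Proof. by move=> cf cg y; exact: (cvgM (cf y) (cg y)). Qed.

Lemma continuous_add f g : continuous f -> continuous g ->
  continuous (fun y : 'rV[R]_n => f y + g y : R).
Proof. by move=> cf cg y; exact: (cvgD (cf y) (cg y)). Qed.

Lemma continuous_sub f g : continuous f -> continuous g ->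
  continuous (fun y : 'rV[R]_n => f y - g y : R).
Proof. by move=> cf cg y; exact: (cvgB (cf y) (cg y)). Qed.

Lemma continuous_constant (c : R) : continuous (fun _ : 'rV[R]_n => c).
Proof. exact: cst_continuous. Qed.

Lemma continuous_scale (c : R) f : continuous f ->
  continuous (fun y : 'rV[R]_n => c * f y : R).
Proof. by apply: continuous_mul; exact: continuous_constant. Qed.

Lemma continuous_abs f : continuous f -> continuous (fun y => `|f y|).
Proof. by move=> cf y; exact: (cvg_norm (cf y)). Qed.

Lemma cvg_sumr (T : Type) (F : set_system T) (FF : Filter F) (I : Type)
    (s : seq I) (f : I -> T -> R) (l : I -> R) :
  (forall i, f i x @[x --> F] --> l i) ->
  \sum_(i <- s) f i x @[x --> F] --> \sum_(i <- s) l i.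
Proof.
move=> fl; elim: s => [|i s IHs].
  by under eq_fun do rewrite big_nil; rewrite big_nil; exact: cvg_cst.
under eq_fun do rewrite big_cons; rewrite big_cons.
exact: cvgD (fl i) IHs.
Qed.

Lemma continuous_sumr (I : finType) (f : I -> 'rV[R]_n -> R) :
  (forall i, continuous (f i)) -> continuous (fun x => \sum_i f i x).
Proof. by move=> cf x; apply: (cvg_sumr (nbhs_filter x)) => i; exact: cf. Qed.

Lemma continuous_row m (v : 'rV[R]_n -> 'rV[R]_m) :
  (forall i, continuous (fun y => v y 0 i)) -> continuous v.
Proof.
move=> cv x; apply/(@cvgrPdist_le _ _ _ _ (nbhs_filter x)) => e e0.
have : \forall y \near x, forall i, `|v x 0 i - v y 0 i| <= e.
  apply: (@filter_forall _ _ _ (nbhs x)) => i.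
  exact: ((cvgrPdist_le _ _).1 (cv i x)).
apply: filterS => y vy; apply: norm_le_coord => [|i]; first exact: ltW.
by rewrite !mxE; exact: vy.
Qed.

End ContinuousRow.

(** * Measurability and dominated convergence *)

Section RowMeasurability.
Context {R : realType} {n : nat}.

Lemma row_of_tupleE (t : n.-tuple R) i : row_of_tuple t 0 i = tnth t i.
Proof. by rewrite mxE. Qed.

(** The sigma-algebra on tuples is the product one, whereas continuity refers to
    the topology of row vectors.  Rounding the coordinates down to the grid of
    mesh [1 / (m + 1)] turns [f] into a function with countably many values,
    taken on measurable boxes, and these functions converge to [f] pointwise by
    continuity. *)
Lemma measurable_continuous_row (f : 'rV[R]_n -> R) : continuous f ->
  measurable_fun [set: n.-tuple R] (f \o row_of_tuple).
Proof.
move=> cf.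
pose q (m : nat) (z : 'rV[int]_n) : 'rV[R]_n := m.+1%:R^-1 *: map_mx intr z.
pose fl (m : nat) (t : n.-tuple R) : 'rV[int]_n :=
  \row_i Num.floor (m.+1%:R * tnth t i).
apply: (@measurable_fun_cvg _ _ _ _ (fun m t => f (q m (fl m t)))) => [m|t _].
  move=> _ Y mY; rewrite setTI.
  rewrite (_ : _ @^-1` Y = \bigcup_(z : 'rV[int]_n)
      ([set t | fl m t = z] `&` [set _ | Y (f (q m z))])); last first.
    by apply/seteqP; split=> [t Yt|t [z _ [/= <-]]//]; exists (fl m t).
  apply: countable_bigcupT_measurable => // z.
  apply: measurableI; last first.
    by have [Yz|nYz] := pselect (Y (f (q m z)));
      [rewrite (_ : mkset _ = setT)//; apply/seteqP; split
      |rewrite (_ : mkset _ = set0)//; apply/seteqP; split].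
  rewrite (_ : mkset _ = \bigcap_(i in [set: 'I_n])
      ((fun t : n.-tuple R => m.+1%:R * tnth t i) @^-1`
        `[(z 0 i)%:~R, (z 0 i + 1)%:~R[%classic)).
    apply: fin_bigcap_measurable => // i _.
    rewrite -[X in measurable X]setTI.
    apply: (@measurable_funM _ _ _ _ (cst m.+1%:R) (fun t => tnth t i)) => //.
    exact: measurable_tnth.
  apply/seteqP; split=> [t /= <- i _|t /= tz].
    by rewrite /= in_itv/= mxE floor_itv.
  apply/rowP => i; rewrite mxE; apply: floor_def.
  by have := tz i Logic.I; rewrite /= in_itv.
suff qt : q m (fl m t) @[m --> \oo] --> row_of_tuple t.
  by apply: (cvg_comp _ _ qt); exact: cf.
apply/cvgrPdist_le => e e0.
near=> m; apply: norm_le_coord => [|i]; first exact: ltW.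
rewrite !mxE; set x := tnth t i.
have m0 : 0 < m.+1%:R :> R by [].
have /andP[fx xf] := floor_itv (m.+1%:R * x).
rewrite -(ler_pM2l m0) -[X in X * _](ger0_norm (ltW m0)) -normrM mulrBr mulVKf ?gt_eqF//.
rewrite ger0_norm ?subr_ge0// lerBlDr (le_trans (ltW xf))// intrD1 addrC lerD2r.
rewrite -ler_pdivrMr// div1r (@le_trans _ _ m%:R) ?ler_nat// ltW//.
by near: m; exact: nbhs_infty_gtr.
Unshelve. all: by end_near. Qed.

End RowMeasurability.

Section DominatedRintegral.
Context d (T : measurableType d) (R : realType).
Variables (mu : {measure set T -> \bar R}) (D : set T) (mD : measurable D).

Lemma dominated_cvg_Rintegral (f_ : nat -> T -> R) (f g : T -> R) :
  (forall m, measurable_fun D (f_ m)) ->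
  (forall x, D x -> f_ ^~ x @ \oo --> f x) ->
  mu.-integrable D (EFin \o g) ->
  (forall m x, D x -> `|f_ m x| <= g x) ->
  \int[mu]_(x in D) f_ m x @[m --> \oo] --> \int[mu]_(x in D) f x.
Proof.
move=> mf_ f_f ig f_g.
have mf : measurable_fun D f by exact: measurable_fun_cvg f_f.
have intf : mu.-integrable D (EFin \o f).
  apply: (le_integrable mD _ _ ig); first exact/measurable_EFinP.
  move=> x Dx /=; rewrite lee_fin (le_trans _ (ler_norm _))//.
  have fx := f_f x Dx; have nfx : `|f_ m x| @[m --> \oo] --> `|f x|.
    exact: (cvg_norm fx).
  rewrite -(cvg_lim _ nfx)//; apply: limr_le; first by apply/cvg_ex; exists `|f x|.
  by near=> m; exact: f_g.
apply: fine_cvg; rewrite fineK; last exact: integrable_fin_num.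
apply: (@dominated_cvg _ _ _ mu _ mD (fun m x => (f_ m x)%:E) _ (EFin \o g)).
- by move=> m; exact/measurable_EFinP.
- by move=> x Dx; apply: cvg_EFin; [exact: nearW|exact: f_f].
- by [].
- exact: ig.
- by move=> m x Dx /=; rewrite lee_fin; exact: f_g.
Unshelve. all: by end_near. Qed.

End DominatedRintegral.

(** * Translations and boxes for the iterated Lebesgue measure *)

Section TranslateTuple.
Context {R : realType}.

(** Spelled out at the measurable type on which the one-dimensional Lebesgue
    measure lives, so that measures can be pushed forward along it. *)
Definition shiftr (c x : measurableTypeR R) : measurableTypeR R := (x : R) + c.

Lemma measurable_shiftr c : measurable_fun setT (shiftr c).
Proof. exact: measurable_funD. Qed.

HB.instance Definition _ c :=
  isMeasurableFun.Build _ _ _ _ _ (measurable_shiftr c).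

Lemma lebesgue_measure_shiftr c (A : set (measurableTypeR R)) :
  measurable A -> lebesgue_measure (shiftr c @^-1` A) = lebesgue_measure A.
Proof.
move=> mA; pose m := pushforward (@lebesgue_measure R) (shiftr c).
transitivity (m A) => //.
apply/esym/(@lebesgue_measure_unique R m) => // _ [[a b]] _ <-.
rewrite -[RHS]/(lebesgue_measure (shiftr c @^-1` _)).
rewrite (_ : _ @^-1` _ = `](a - c : R), (b - c : R)]%classic).
  rewrite !lebesgue_measure_itv/= !lte_fin ltrD2r -!EFinB.
  by rewrite (_ : b - c - (a - c) = b - a)//; ring.
by apply/seteqP; split=> x /=; rewrite !in_itv/= /shiftr ltrBlDr lerBrDr.
Qed.

Definition translate {n} (c : 'I_n -> R) (t : n.-tuple R) : n.-tuple R :=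
  [tuple tnth t i + c i | i < n].

Lemma measurable_translate n (c : 'I_n -> R) :
  measurable_fun [set: n.-tuple R] (translate c).
Proof.
apply/measurable_fun_tnthP => i.
rewrite (_ : _ \o _ = (fun t => tnth t i + c i)); last first.
  by apply/funext => t /=; rewrite tnth_mktuple.
by apply: measurable_funD => //; exact: measurable_tnth.
Qed.

HB.instance Definition _ n (c : 'I_n -> R) :=
  isMeasurableFun.Build _ _ _ _ (translate c) (measurable_translate c).

Definition shiftr_translate n (c : 'I_n.+1 -> R)
    (z : measurableTypeR R * n.-tuple R) : measurableTypeR R * n.-tuple R :=
  (shiftr (c ord0) z.1, translate (c \o lift ord0) z.2).

Lemma measurable_shiftr_translate n (c : 'I_n.+1 -> R) :
  measurable_fun setT (shiftr_translate c).
Proof.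
apply/measurable_fun_pair.
  exact: (measurableT_comp (measurable_shiftr _) measurable_fst).
exact: (measurableT_comp (measurable_translate _) measurable_snd).
Qed.

HB.instance Definition _ n (c : 'I_n.+1 -> R) :=
  isMeasurableFun.Build _ _ _ _ _ (measurable_shiftr_translate c).

Lemma translate_tcons n (c : 'I_n.+1 -> R) :
  translate c \o @tcons R n = @tcons R n \o shiftr_translate c.
Proof.
apply/funext => -[x t]; apply: eq_from_tnth => i /=.
rewrite tnth_mktuple /tcons/=; case: (unliftP ord0 i) => [j|] ->.
  by rewrite !tnthS tnth_mktuple.
by rewrite !tnth0.
Qed.

(** Induction on the dimension: on a rectangle both sides factor, the first factor
    being invariant on the line and the second by induction, and a product
    measure is determined by its values on rectangles. *)
Lemma lebesgue_tuple_translate n (c : 'I_n -> R) (A : set (n.-tuple R)) :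
  measurable A -> lebesgue_tuple n (translate c @^-1` A) = lebesgue_tuple n A.
Proof.
elim: n c A => [|n IHn] c A mA.
  congr (_ _ _); apply/seteqP.
  by split=> t; rewrite /= (tuple0 t) (tuple0 (translate _ _)).
have mtA : measurable (@tcons R n @^-1` A).
  by rewrite -[X in measurable X]setTI; exact: measurable_tcons.
rewrite /= /lebesgue_cons /pushforward -comp_preimage translate_tcons.
rewrite comp_preimage.
pose m := pushforward (@lebesgue_measure R \x lebesgue_tuple n)%E
  (shiftr_translate c).
apply/esym/(@product_measure_unique _ _ _ _ _ _ _ m) => // B D mB mD.
rewrite -[LHS]/((_ \x _)%E (shiftr_translate c @^-1` _)).
rewrite (_ : _ @^-1` _ = (shiftr (c ord0) @^-1` B) `*`
    (translate (c \o lift ord0) @^-1` D)); last by apply/seteqP; split=> -[].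
have mB' : measurable (shiftr (c ord0) @^-1` B).
  by rewrite -[X in measurable X]setTI; exact: measurable_shiftr.
have mD' : measurable (translate (c \o lift ord0) @^-1` D).
  by rewrite -[X in measurable X]setTI; exact: measurable_translate.
rewrite product_measure1E//; congr (_ * _)%E; last exact: IHn.
exact: lebesgue_measure_shiftr.
Qed.

End TranslateTuple.

Section LebesgueTuple.
Context {R : realType}.

Definition tuple_box {n} (c : 'I_n -> R) (r : R) : set (n.-tuple R) :=
  [set t | forall i, c i - r < tnth t i < c i + r].

Lemma measurable_tuple_box n (c : 'I_n -> R) r : measurable (tuple_box c r).
Proof.
rewrite (_ : tuple_box c r = \bigcap_(i in [set: 'I_n])
    ((fun t : n.-tuple R => tnth t i) @^-1` `]c i - r, c i + r[%classic)).
  apply: fin_bigcap_measurable => // i _.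
  by rewrite -[X in measurable X]setTI; exact: measurable_tnth.
apply/seteqP; split=> t /= h i; first by rewrite /= in_itv/= => _; exact: h.
by have := h i Logic.I; rewrite /= in_itv.
Qed.

(** Finiteness of this value makes bounded functions with bounded support
    integrable; its positivity makes a nonnegative continuous function that is
    somewhere positive have a positive integral. *)
Lemma lebesgue_tuple_box n (c : 'I_n -> R) r : 0 < r ->
  lebesgue_tuple n (tuple_box c r) = ((r *+ 2) ^+ n)%:E.
Proof.
move=> r0; elim: n c => [|n IHn] c.
  by rewrite /= diracE expr0 mem_set// => -[].
rewrite /= /lebesgue_cons /pushforward.
rewrite (_ : _ @^-1` _ = `](c ord0 - r), (c ord0 + r)[%classic `*`
    tuple_box (c \o lift ord0) r).
  rewrite product_measure1E//; last exact: measurable_tuple_box.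
  rewrite exprS EFinM; congr (_ * _)%E; last exact: IHn.
  rewrite -[LHS]/(lebesgue_measure _) lebesgue_measure_itv/= lte_fin.
  by rewrite ltrD2l gtrN// -EFinB; congr EFin; rewrite mulr2n; ring.
apply/seteqP; split=> -[x t] /=.
  move=> h; split; first by have := h ord0; rewrite /= in_itv/= tnth0.
  by move=> i /=; have := h (lift ord0 i); rewrite tnthS.
move=> [/=]; rewrite in_itv/= => hx ht i.
by case: (unliftP ord0 i) => [j|] ->; rewrite ?tnthS ?tnth0//; exact: ht.
Qed.

Lemma measurable_unit_cube n : measurable (@unit_cube R n).
Proof.
rewrite (_ : unit_cube = \bigcap_(i in [set: 'I_n])
    ((fun t : n.-tuple R => tnth t i) @^-1` `[0, 1[%classic)).
  apply: fin_bigcap_measurable => // i _.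
  by rewrite -[X in measurable X]setTI; exact: measurable_tnth.
apply/seteqP; split=> t /= h i; first by rewrite /= in_itv/= => _; exact: h.
by have := h i Logic.I; rewrite /= in_itv.
Qed.

(** Used for the set of points congruent to [x0], where the sign of [theta] is
    unknown. *)
Lemma lebesgue_tuple_head_null n (A : set R) :
  measurable A -> lebesgue_measure A = 0%E ->
  lebesgue_tuple n.+1 [set t | A (tnth t ord0)] = 0%E.
Proof.
move=> mA A0; rewrite /= /lebesgue_cons /pushforward.
rewrite (_ : _ @^-1` _ = A `*` setT).
  by rewrite product_measure1E// [X in (X * _)%E]A0 mul0e.
by apply/seteqP; split=> -[x t] /=; rewrite tnth0// => -[].
Qed.

Lemma space_integral_translate n (f : 'rV[R]_n -> R) (c : 'rV[R]_n) :
  continuous f ->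
  (lebesgue_tuple n).-integrable setT (EFin \o (fun t => f (row_of_tuple t + c))) ->
  space_integral (fun x => f (x + c)) = space_integral f.
Proof.
move=> cf fc; rewrite /space_integral /Rintegral; congr fine.
pose tr := translate (c 0).
have row_tr t : row_of_tuple (tr t) = row_of_tuple t + c.
  by apply/rowP => i; rewrite !mxE tnth_mktuple.
transitivity (\int[pushforward (lebesgue_tuple n) tr]_t
    (f (row_of_tuple t))%:E)%E.
  have mf : measurable_fun setT (fun t => (f (row_of_tuple t))%:E).
    by apply/measurable_EFinP; exact: measurable_continuous_row.
  have fc' : (lebesgue_tuple n).-integrable (tr @^-1` setT)
      ((fun t => (f (row_of_tuple t))%:E) \o tr).
    by rewrite preimage_setT /comp; under eq_fun do rewrite row_tr.
  rewrite (integral_pushforward (measurable_translate (c 0)) mf fc' measurableT).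
  by apply: eq_integral => t _ /=; rewrite -/tr row_tr.
by apply: eq_measure_integral => A mA _; exact: lebesgue_tuple_translate.
Qed.

End LebesgueTuple.

(** * Functions with bounded support *)

(** The sup norm is used because its balls are boxes, whose measure is explicit. *)
Definition vanishes_off {R : realType} {n} (r : R) (K : 'rV[R]_n -> R) :=
  forall y, r < `|y| -> K y = 0.

Section CompactlySupported.
Context {R : realType} {n : nat}.
Local Notation mu := (@lebesgue_tuple R n).
Implicit Types (K f : 'rV[R]_n -> R) (r M : R).

Lemma box_indic_integrable (c : 'I_n -> R) r : 0 < r ->
  mu.-integrable setT (EFin \o \1_(tuple_box c r)).
Proof.
move=> r0; have mB := measurable_tuple_box c r.
apply/integrableP; split; first by apply/measurable_EFinP; exact: measurable_indic.
rewrite (eq_integral (EFin \o \1_(tuple_box c r))).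
  by rewrite integral_indic// setIT [ltLHS](lebesgue_tuple_box _ r0) ltry.
by move=> t _; rewrite gee0_abs// lee_fin.
Qed.

(** The open box of half-width [`|r| + 1] contains the closed ball of radius [r];
    the absolute value keeps the half-width positive when [r] is not. *)
Definition ball_majorant r M (t : n.-tuple R) : R :=
  M * \1_(tuple_box (fun=> 0) (`|r| + 1)) t.

Lemma ball_majorant_integrable r M :
  mu.-integrable setT (EFin \o ball_majorant r M).
Proof.
have r0 : 0 < `|r| + 1 by rewrite ltr_wpDl.
exact: (integrableZl measurableT M (box_indic_integrable _ r0)).
Qed.

Lemma ball_majorant_ge0 r M t : 0 <= M -> 0 <= ball_majorant r M t.
Proof. by move=> M0; rewrite mulr_ge0. Qed.

Lemma le_ball_majorant r M (y : R) t : 0 <= M ->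
  (`|row_of_tuple t| <= r -> `|y| <= M) ->
  (r < `|row_of_tuple t| -> y = 0) ->
  `|y| <= ball_majorant r M t.
Proof.
move=> M0 yM y0; have [tr|rt] := leP `|row_of_tuple t| r; last first.
  by rewrite (y0 rt) normr0 ball_majorant_ge0.
rewrite /ball_majorant indicE mem_set ?mulr1; first exact: yM.
move=> i; rewrite !add0r -ltr_norml -row_of_tupleE.
rewrite (le_lt_trans (coord_le_norm _ _))// (le_lt_trans tr)//.
by rewrite ltr_pwDr// ler_norm.
Qed.

Lemma compactly_supported_integrable K r : continuous K -> vanishes_off r K ->
  mu.-integrable setT (EFin \o (K \o row_of_tuple)).
Proof.
move=> cK K0; have [M M0 KM] := continuous_bounded_ball cK r.
apply: (le_integrable measurableT _ _ (ball_majorant_integrable r M)).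
  by apply/measurable_EFinP; exact: measurable_continuous_row.
move=> t _ /=; rewrite lee_fin (le_trans _ (ler_norm _))//.
by apply: le_ball_majorant => //; [exact: KM|exact: K0].
Qed.

End CompactlySupported.

(** * Directional derivatives and classes of differentiability *)

Section LineDerivative.
Context {R : realType} {n : nat}.
Implicit Types (f : 'rV[R]_n -> R) (x e : 'rV[R]_n).

(** Relates the difference quotient along [e] to that of a function of one real
    variable, to which differentiation under the integral sign applies. *)
Lemma line_quotient f x e (h : R) :
  (fun k : R => k^-1 *: (((fun s => f (x + s *: e)) \o shift h) (k *: 1)
                          - f (x + h *: e))) =
  (fun k : R => k^-1 *: ((f \o shift (x + h *: e)) (k *: e) - f (x + h *: e))).
Proof.
apply/funext => k /=; congr (_ *: (f _ - _)).
by rewrite [k%:A]mulr1 scalerDl addrCA.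
Qed.

Lemma line_is_derive f x e (h : R) : derivable f (x + h *: e) e ->
  is_derive h 1 (fun s => f (x + s *: e)) ('D_e f (x + h *: e)).
Proof.
move=> df; apply: DeriveDef; rewrite ?/derivable ?/derive line_quotient//.
Qed.

Lemma derive_line f x e (l : R) : is_derive (0 : R) (1 : R) (fun s => f (x + s *: e)) l ->
  is_derive x e f l.
Proof.
move=> [dfl fl]; have := @line_quotient f x e 0.
rewrite scale0r addr0 => Q; split.
  by move: dfl; rewrite /derivable scale0r addr0 Q.
by move: fl; rewrite /derive scale0r addr0 Q.
Qed.

End LineDerivative.

Section PartialDerivatives.
Context {R : realType} {n : nat}.
Implicit Types (K f g : 'rV[R]_n -> R) (x e : 'rV[R]_n).

Lemma Ck_continuous k f : Ck k f -> continuous f.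
Proof. by case: k => [//|k] []. Qed.

Lemma Ck2_derivable f i : Ck 2 f -> forall x, derivable f x (delta_mx 0 i).
Proof. by move=> [_ /(_ i)[]]. Qed.

Lemma Ck2_partial_continuous f i : Ck 2 f -> continuous (partial i f).
Proof. by move=> [_ /(_ i)[_ []]]. Qed.

Lemma Ck2_partial_derivable f i : Ck 2 f ->
  forall x, derivable (partial i f) x (delta_mx 0 i).
Proof. by move=> [_ /(_ i)[_ [_ /(_ i)[]]]]. Qed.

Lemma Ck2_partial2_continuous f i : Ck 2 f -> continuous (partial i (partial i f)).
Proof. by move=> [_ /(_ i)[_ [_ /(_ i)[]]]]. Qed.

(** As the condition [r < `|y|] is open, [K] vanishes in a neighbourhood of each
    such [y]. *)
Lemma vanishes_off_derive K r e : vanishes_off r K ->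
  vanishes_off r (fun y => 'D_e K y).
Proof.
move=> K0 y ry; apply: cvg_lim => //; apply: cvg_near_cst.
have e0 : 0 < (`|y| - r) / (`|e| + 1) by rewrite divr_gt0 ?subr_gt0// ltr_wpDl.
near=> h; rewrite /= (K0 y)// K0 ?subr0 ?scaler0//.
rewrite -[h *: e]opprK addrC (lt_le_trans _ (lerB_dist _ _))// ltrBrDl -ltrBrDr.
rewrite normrN normrZ.
have : `|h| * (`|e| + 1) < `|y| - r.
  by rewrite -ltr_pdivlMr ?ltr_wpDl//; near: h; exact: dnbhs0_lt.
by apply: le_lt_trans; rewrite ler_wpM2l// lerDl.
Unshelve. all: by end_near. Qed.

(** Covers the rescaling of kernels and, with [c = -1] and [s = 1], their
    negation. *)
Lemma derive_rescale f (c s : R) x e : derivable f (s *: x) e ->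
  is_derive x e (fun y => c * f (s *: y)) (c * s * 'D_e f (s *: x)).
Proof.
move=> df; apply: derive_line.
rewrite (_ : (fun h : R => _) =
    c \*: ((fun k => f (s *: x + k *: e)) \o (s \*: id))); last first.
  by apply/funext => h /=; rewrite scalerDr scalerA.
rewrite -mulrA; apply: is_deriveZ; rewrite mulrC.
apply: is_derive1_comp; last first.
  exact: is_derive_eq (is_deriveZ s (is_derive_id (0 : R) (1 : R))) (mulr1 s).
rewrite /= scaler0.
have := @line_is_derive _ _ f (s *: x) e 0; rewrite scale0r addr0; exact.
Qed.

Lemma Ck_rescale k f (c s : R) : Ck k f -> Ck k (fun y => c * f (s *: y)).
Proof.
have cont g (d : R) : continuous g -> continuous (fun y : 'rV[R]_n => d * g (s *: y)).
  move=> cg; apply: continuous_scale.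
  move=> y; have h : (fun z => s *: z) @ nbhs y --> nbhs (s *: y).
    exact: scaler_continuous.
  exact: (cvg_comp _ _ h (cg _)).
elim: k f c => [|k IHk] f c /=; first exact: cont.
move=> [cf df]; split=> [|i]; first exact: cont.
have [dfi Cfi] := df i.
have D x := @derive_rescale f c s x _ (dfi (s *: x)).
split=> [x|]; first by have [] := D x.
rewrite (_ : partial i _ = (fun y => (c * s) * partial i f (s *: y))).
  exact: IHk.
by apply/funext => x; have [] := D x.
Qed.

Lemma Ck_opp k f : Ck k f -> Ck k (fun y => - f y).
Proof.
move=> /(Ck_rescale (-1) 1); congr (Ck k _); apply/funext => y.
by rewrite scale1r mulN1r.
Qed.

Lemma derive_periodic f e : Zperiodic f -> Zperiodic (fun x => 'D_e f x).
Proof.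
move=> pf k x; rewrite /derive.
rewrite (_ : (fun h : R => _) =
    (fun h : R => h^-1 *: ((f \o shift x) (h *: e) - f x)))//.
by apply/funext => h /=; rewrite addrA !pf.
Qed.

Lemma Ck_sub k f g : Ck k f -> Ck k g -> Ck k (fun x => f x - g x).
Proof.
elim: k f g => [|k IHk] f g; first exact: continuous_sub.
move=> [cf df] [cg dg]; split=> [|i]; first exact: continuous_sub.
have [[dfi Cfi] [dgi Cgi]] := (df i, dg i).
split=> [x|]; first exact: derivableB.
rewrite (_ : partial i _ = (fun x => partial i f x - partial i g x)).
  exact: IHk.
by apply/funext => x; exact: deriveB.
Qed.

End PartialDerivatives.

(** * Moving averages *)

(** The integration variable is added, as in [mollify], so that
    [mollify gamma eta w] is [correlate (rescale gamma eta) w] by definition. *)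
Definition correlate {R : realType} {n} (K f : 'rV[R]_n -> R) (x : 'rV[R]_n) : R :=
  space_integral (fun y => K y * f (x + y)).

Section Correlate.
Context {R : realType} {n : nat}.
Local Notation mu := (@lebesgue_tuple R n).
Implicit Types (K f : 'rV[R]_n -> R) (r M : R).

Lemma correlate_integrable K f r x : continuous K -> vanishes_off r K ->
  continuous f ->
  mu.-integrable setT (EFin \o (fun t => K (row_of_tuple t) * f (x + row_of_tuple t))).
Proof.
move=> cK K0 cf.
apply: (@compactly_supported_integrable _ _ (fun y => K y * f (x + y)) r).
  by apply: continuous_mul; [exact: cK|exact: continuous_shift].
by move=> y /K0 ->; rewrite mul0r.
Qed.

Lemma correlate_continuous K f r M : continuous K -> vanishes_off r K ->
  continuous f -> (forall x, `|f x| <= M) -> continuous (correlate K f).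
Proof.
move=> cK K0 cf fM x; apply: sequential_continuous => u ux.
apply: (@dominated_cvg_Rintegral _ _ _ mu _ measurableT
  (fun m t => K (row_of_tuple t) * f (u m + row_of_tuple t)) _
  (fun t => M * `|K (row_of_tuple t)|)).
- move=> m; apply: (@measurable_continuous_row _ _ (fun y => K y * f (u m + y))).
  by apply: continuous_mul; [exact: cK|exact: continuous_shift].
- move=> t _; apply: cvgM; first exact: cvg_cst.
  have ut : u m + row_of_tuple t @[m --> \oo] --> x + row_of_tuple t.
    by apply: cvgD => //; exact: cvg_cst.
  exact: (cvg_comp _ _ ut (cf _)).
- exact: (integrableZl measurableT M
    (integrable_norm (compactly_supported_integrable cK K0))).
- by move=> m t _; rewrite normrM mulrC ler_wpM2r.
Qed.

Lemma correlate_periodic K f : Zperiodic f -> Zperiodic (correlate K f).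
Proof.
move=> pf k x; rewrite /correlate; congr space_integral; apply/funext => y.
by rewrite addrAC pf.
Qed.

(** Differentiation under the integral sign: the quotient acts on [f] alone, and
    [M * `|K|] dominates the derivative of the integrand. *)
Lemma correlate_derive K f r M (e : 'rV[R]_n) :
  continuous K -> vanishes_off r K -> continuous f ->
  (forall x, derivable f x e) -> (forall x, `|'D_e f x| <= M) ->
  forall x, is_derive x e (correlate K f) (correlate K (fun y => 'D_e f y) x).
Proof.
move=> cK K0 cf df fM x; apply: derive_line.
pose ff (h : R) (t : n.-tuple R) :=
  K (row_of_tuple t) * f (x + h *: e + row_of_tuple t).
have dff (h : R) t : is_derive h (1 : R) (ff ^~ t)
    (K (row_of_tuple t) * 'D_e f (x + h *: e + row_of_tuple t)).
  rewrite (_ : ff ^~ t = K (row_of_tuple t) \*: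
      (fun s => f ((x + row_of_tuple t) + s *: e))); last first.
    by apply/funext => s; rewrite /ff/= addrAC.
  apply: is_deriveZ; rewrite addrAC; apply: line_is_derive; exact: df.
have I0 : `]-1, 1[%classic (0 : R) by rewrite /= in_itv/= ltrN10 ltr01.
have intf h : `]-1, 1[%classic h -> mu.-integrable setT (EFin \o ff h).
  by move=> _; exact: correlate_integrable cK K0 cf.
have derf h t : `]-1, 1[%classic h -> setT t -> derivable (ff ^~ t) h (1 : R).
  by move=> _ _; have [] := dff h t.
pose G t := M * `|K (row_of_tuple t)|.
have M0 : 0 <= M by rewrite (le_trans _ (fM 0)).
have G0 t : 0 <= G t by rewrite mulr_ge0.
have intG : mu.-integrable setT (EFin \o G).
  exact: (integrableZl measurableT M
    (integrable_norm (compactly_supported_integrable cK K0))).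
have G_ub h t : `]-1, 1[%classic h -> setT t -> `|partial1of2 ff h t| <= G t.
  move=> _ _; rewrite partial1of2E; have [_ ->] := dff h t.
  by rewrite normrM mulrC ler_wpM2r.
have D := derivable_under_integral measurableT I0 intf derf G0 intG G_ub.
have E := differentiation_under_integral measurableT I0 intf derf G0 intG G_ub.
split; first exact: D.
rewrite -derive1E [LHS]E; apply: eq_Rintegral => t _.
rewrite -[LHS]/(partial1of2 ff 0 t) partial1of2E; have [_ ->] := dff 0 t.
by rewrite scale0r addr0.
Qed.

(** Substituting [z = x + y] moves the dependence on [x] from [f], which may be
    merely continuous, to the kernel. *)
Lemma correlateE K f r x : continuous K -> vanishes_off r K -> continuous f ->
  correlate K f x = space_integral (fun z => K (z - x) * f z).
Proof.
move=> cK K0 cf; rewrite -(@space_integral_translate _ _ _ x).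
- by congr space_integral; apply/funext => y; rewrite addrK addrC.
- apply: continuous_mul; last exact: cf.
  under eq_fun do rewrite addrC.
  exact: continuous_shift.
- have := correlate_integrable x cK K0 cf; congr (_.-integrable _ _).
  by apply/funext => t /=; rewrite addrK addrC.
Qed.

(** With [x] in the kernel, the integrand stays differentiable even where [f] is
    not.  The kernels shifted by [x + h *: e] with [`|h| < 1] all vanish outside
    one fixed ball, which provides the dominating function. *)
Lemma correlate_derive_kernel K f r M (e : 'rV[R]_n) :
  continuous K -> vanishes_off r K -> continuous f ->
  (forall y, derivable K y e) -> continuous (fun y => 'D_e K y) ->
  vanishes_off r (fun y => 'D_e K y) ->
  (forall x, `|f x| <= M) ->
  forall x, is_derive x e (correlate K f) (correlate (fun y => - 'D_e K y) f x).
Proof.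
move=> cK K0 cf dK cDK DK0 fM x; apply: derive_line.
have cshift (g : 'rV[R]_n -> R) (c : 'rV[R]_n) : continuous g ->
    continuous (fun z : 'rV[R]_n => g (z - c)).
  by move=> cg; under eq_fun do rewrite addrC; exact: continuous_shift.
pose ff (h : R) (t : n.-tuple R) :=
  K (row_of_tuple t - (x + h *: e)) * f (row_of_tuple t).
have dff (h : R) t : is_derive h (1 : R) (ff ^~ t)
    (- 'D_e K (row_of_tuple t - (x + h *: e)) * f (row_of_tuple t)).
  rewrite (_ : ff ^~ t = f (row_of_tuple t) \*:
      ((fun s => K ((row_of_tuple t - x) + s *: e)) \o -%R)); last first.
    by apply/funext => s; rewrite /ff/= mulrC scaleNr opprD addrA.
  rewrite mulrC; apply: is_deriveZ.
  rewrite -mulrN1 [X in X * _](_ : _ = 'D_e K (row_of_tuple t - x + (- h) *: e)).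
    by apply: is_derive1_comp; apply: line_is_derive; exact: dK.
  by rewrite scaleNr opprD addrA.
have I0 : `]-1, 1[%classic (0 : R) by rewrite /= in_itv/= ltrN10 ltr01.
(* Whenever [r' < `|z|], the point [z - (x + h *: e)] is outside the support of
   [K], for every [h] with [`|h| < 1]. *)
pose r' := r + `|x| + `|e|.
have far h (z : 'rV[R]_n) : `]-1, 1[%classic h -> r' < `|z| ->
    r < `|z - (x + h *: e)|.
  rewrite /= in_itv/= => /andP[h1 h2] rz.
  rewrite (lt_le_trans _ (lerB_dist _ _))// ltrBrDr (le_lt_trans _ rz)//.
  rewrite /r' -addrA lerD2l (le_trans (ler_normD _ _))// lerD2l normrZ.
  by rewrite ler_piMl// ltW// ltr_norml h1.
have intf h : `]-1, 1[%classic h -> mu.-integrable setT (EFin \o ff h).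
  move=> Ih; apply: (@compactly_supported_integrable _ _
      (fun z => K (z - (x + h *: e)) * f z) r').
    by apply: continuous_mul; [exact: cshift|exact: cf].
  by move=> z /(far _ _ Ih) /K0 ->; rewrite mul0r.
have derf h t : `]-1, 1[%classic h -> setT t -> derivable (ff ^~ t) h (1 : R).
  by move=> _ _; have [] := dff h t.
have [N N0 DKN] := continuous_bounded_ball cDK r.
have {}DKN y : `|'D_e K y| <= N.
  by have [/DKN//|/DK0 ->] := leP `|y| r; rewrite normr0.
have M0 : 0 <= M by rewrite (le_trans _ (fM 0)).
pose G := @ball_majorant R n r' (N * M).
have G0 t : 0 <= G t by rewrite ball_majorant_ge0// mulr_ge0.
have intG : mu.-integrable setT (EFin \o G) by exact: ball_majorant_integrable.
have G_ub h t : `]-1, 1[%classic h -> setT t -> `|partial1of2 ff h t| <= G t.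
  move=> Ih _; rewrite partial1of2E; have [_ ->] := dff h t.
  apply: le_ball_majorant; first exact: mulr_ge0.
    by move=> _; rewrite normrM normrN ler_pM.
  by move=> /(far _ _ Ih) /DK0 ->; rewrite oppr0 mul0r.
have cffE h : correlate K f (x + h *: e) = \int[mu]_t ff h t.
  exact: (correlateE _ cK K0 cf).
have D := derivable_under_integral measurableT I0 intf derf G0 intG G_ub.
have E := differentiation_under_integral measurableT I0 intf derf G0 intG G_ub.
under eq_fun do rewrite cffE.
split; first exact: D.
rewrite -derive1E [LHS]E (@correlateE _ _ r)//.
- apply: eq_Rintegral => t _.
  rewrite -[LHS]/(partial1of2 ff 0 t) partial1of2E; have [_ ->] := dff 0 t.
  by rewrite scale0r addr0.
- by move=> y; exact: (cvgN (cDK y)).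
- by move=> y /DK0 ->; rewrite oppr0.
Qed.

End Correlate.

Section CorrelateSmooth.
Context {R : realType} {n : nat}.
Implicit Types (K f g : 'rV[R]_n -> R).

(** Each derivative of the average is again an average of [f], with the kernel
    [- partial i K], so the induction is on the regularity of the kernel. *)
Lemma correlate_Ck k K f r M : Ck k K -> vanishes_off r K ->
  continuous f -> (forall x, `|f x| <= M) -> Ck k (correlate K f).
Proof.
move=> + + cf fM; elim: k K => [|k IHk] K CK K0.
  exact: correlate_continuous CK K0 cf fM.
have cK := Ck_continuous CK; move: CK => [_ dK].
split=> [|i]; first exact: correlate_continuous cK K0 cf fM.
have [dKi CKi] := dK i.
have DK0 : vanishes_off r (partial i K) by exact: vanishes_off_derive.
have D := correlate_derive_kernel cK K0 cf dKi (Ck_continuous CKi) DK0 fM.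
split=> [x|]; first by have [] := D x.
rewrite (_ : partial i _ = correlate (fun y => - partial i K y) f).
  apply: IHk; first exact: Ck_opp.
  by move=> y /DK0 ->; rewrite oppr0.
by apply/funext => x; have [] := D x.
Qed.

Definition averaging_kernel (r : R) K :=
  [/\ continuous K, vanishes_off r K, forall y, 0 <= K y & space_integral K = 1].

(** Since [K] is a probability density, the average differs from [c] by the average
    of [g - c], and only the values of [g] within distance [r] of [x] matter.
    It yields the uniform bound (with [c = 0]) and the convergence of averages
    (with [c = g x]). *)
Lemma correlate_near_value r K g (c e : R) x : averaging_kernel r K ->
  continuous g -> (forall y, `|y| <= r -> `|g (x + y) - c| <= e) ->
  `|correlate K g x - c| <= e.
Proof.
move=> [cK K0 Kge0 K1] cg gce.
have iK := compactly_supported_integrable cK K0.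
have iKg := correlate_integrable x cK K0 cg.
have cgc : continuous (fun y => g y - c).
  by apply: continuous_sub => //; exact: continuous_constant.
have iKgc := correlate_integrable x cK K0 cgc.
have -> : correlate K g x - c = correlate K (fun y => g y - c) x.
  rewrite -[X in _ - X]mul1r -K1 -RintegralZr// -RintegralB//.
    by apply: eq_Rintegral => t _ /=; rewrite mulrBr.
  under eq_fun do rewrite mulrC.
  exact: (integrableZl measurableT c iK).
rewrite (le_trans (le_normr_Rintegral measurableT iKgc))//.
have -> : e = \int[lebesgue_tuple n]_t (e * K (row_of_tuple t)).
  by rewrite RintegralZl// -[X in _ * X]/(space_integral K) K1 mulr1.
apply: le_Rintegral => //.
- exact: integrable_norm iKgc.
- exact: (integrableZl measurableT e iK).
- move=> t _; rewrite normrM (ger0_norm (Kge0 _)) mulrC.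
  have [tr|rt] := leP `|row_of_tuple t| r; last by rewrite (K0 _ rt) !mulr0.
  by rewrite ler_wpM2r// gce.
Qed.

Lemma correlate_le r K g (M : R) x : averaging_kernel r K ->
  continuous g -> (forall y, `|g y| <= M) -> `|correlate K g x| <= M.
Proof.
move=> kK cg gM; rewrite -[correlate K g x]subr0.
by apply: (correlate_near_value kK cg) => y _; rewrite subr0.
Qed.

Lemma correlate_cvg (r : nat -> R) (K : nat -> 'rV[R]_n -> R) g x :
  r m @[m --> \oo] --> 0 -> (forall m, averaging_kernel (r m) (K m)) ->
  continuous g -> correlate (K m) g x @[m --> \oo] --> g x.
Proof.
move=> r0 kK cg; apply/cvgrPdist_le => e e0.
have /cvgrPdist_le/(_ e e0) := cg x.
move=> /nbhs_ballP[d /= d0 dg].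
near=> m; rewrite distrC; apply: (correlate_near_value (kK m) cg) => y yr.
rewrite distrC; apply: dg; rewrite -ball_normE /= opprD addNKr normrN.
rewrite (le_lt_trans yr)// (le_lt_trans (ler_norm _))//.
by near: m; exact: cvgr0_norm_lt.
Unshelve. all: by end_near. Qed.

Lemma space_integral_gt0 g r y0 : continuous g -> vanishes_off r g ->
  (forall y, 0 <= g y) -> 0 < g y0 -> 0 < space_integral g.
Proof.
move=> cg g0 gge0 gy0; have e0 : 0 < g y0 / 2 by rewrite divr_gt0.
have /cvgrPdist_le/(_ _ e0)/nbhs_ballP[d /= d0 dg] := cg y0.
have d20 : 0 < d / 2 by rewrite divr_gt0.
have iB := box_indic_integrable (y0 0) d20.
apply: (@lt_le_trans _ _ (\int[lebesgue_tuple n]_t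
    (g y0 / 2 * \1_(tuple_box (y0 0) (d / 2)) t))).
  rewrite RintegralZl// mulr_gt0// /Rintegral integral_indic ?setIT//.
    by rewrite [X in fine X](lebesgue_tuple_box _ d20)/= exprn_gt0// mulrn_wgt0.
  exact: measurable_tuple_box.
apply: le_Rintegral => //.
- exact: (integrableZl measurableT _ iB).
- exact: compactly_supported_integrable g0.
- move=> t _; rewrite indicE.
  have [/set_mem tB|] := boolP (t \in _); last by rewrite mulr0.
  rewrite mulr1; have /dg : ball y0 d (row_of_tuple t).
    rewrite -ball_normE /=; apply: (@le_lt_trans _ _ (d / 2)); last lra.
    apply: norm_le_coord => [|i]; first exact: ltW.
    have /andP[t1 t2] := tB i; rewrite !mxE ler_norml.
    by apply/andP; split; lra.
  by rewrite ler_norml => /andP[]; lra.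
Qed.

End CorrelateSmooth.

Section Mollifier.
Context {R : realType} {n : nat} (gamma : 'rV[R]_n -> R).
Hypothesis hgamma : mollifier gamma.

Lemma mollifier_vanishes : vanishes_off 1 gamma.
Proof.
have [_ _ supp _] := hgamma; move=> y y1; apply/eqP; apply: contraT => gy.
have /supp /= : closure [set y | gamma y != 0] y by exact: subset_closure.
by rewrite leNgt (lt_le_trans y1 (norm_le_enorm y)).
Qed.

Lemma rescaled_vanishes (c s : R) : 0 < s ->
  vanishes_off s^-1 (fun y => c * gamma (s *: y)).
Proof.
move=> s0 y sy; rewrite mollifier_vanishes ?mulr0// normrZ gtr0_norm//.
by rewrite mulrC -ltr_pdivrMr// div1r.
Qed.

Lemma mollify_Cinfty (eta : R) f M : 0 < eta -> continuous f ->
  (forall x, `|f x| <= M) -> Cinfty (mollify gamma eta f).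
Proof.
move=> eta0 cf fM k; have [Cg _ _ _] := hgamma.
apply: (@correlate_Ck _ _ k (rescale gamma eta) _ eta) fM => //.
  exact/Ck_rescale/Cg.
by have := @rescaled_vanishes (eta ^- n) eta^-1; rewrite invrK invr_gt0; apply.
Qed.

Lemma mollifier_pos : exists y, 0 < gamma y.
Proof.
have [_ gge0 _ g1] := hgamma; apply: contrapT => /forallNP h.
have := g1; rewrite integral0_eq.
  by move=> /eqP; rewrite eqe eq_sym oner_eq0.
move=> t _; congr EFin; apply/eqP; rewrite normr_eq0 eq_le gge0 andbT leNgt.
exact/negP.
Qed.

(** The kernel [gamma] concentrated at scale [1 / (m + 1)].  Dividing by the
    integral, instead of multiplying by the power of the scale, spares a change
    of variables in dimension [n]. *)
Definition shrinking_kernel (m : nat) (y : 'rV[R]_n) : R :=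
  (space_integral (fun z => gamma (m.+1%:R *: z)))^-1 * gamma (m.+1%:R *: y).

Lemma shrinking_kernel_Cinfty m : Cinfty (shrinking_kernel m).
Proof. by have [Cg _ _ _] := hgamma => k; exact/Ck_rescale/Cg. Qed.

Lemma shrinking_kernel_averaging m :
  averaging_kernel m.+1%:R^-1 (shrinking_kernel m).
Proof.
have [Cg gge0 _ _] := hgamma; have [y0 gy0] := mollifier_pos.
pose g z := gamma (m.+1%:R *: z).
have cg : continuous g.
  have := @Ck_rescale _ _ 0 gamma 1 m.+1%:R (Cg 0%N).
  by rewrite (_ : (fun y => _) = g)//; apply/funext => y; rewrite mul1r.
have g0 : vanishes_off m.+1%:R^-1 g.
  have := @rescaled_vanishes 1 m.+1%:R; rewrite ltr0n => /(_ isT).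
  by rewrite (_ : (fun y => _) = g)//; apply/funext => y; rewrite mul1r.
have Z0 : 0 < space_integral g.
  apply: (space_integral_gt0 (y0 := m.+1%:R^-1 *: y0) cg g0) => [y|].
    exact: gge0.
  by rewrite /g scalerA divff ?scale1r.
split.
- exact: (shrinking_kernel_Cinfty m 0%N).
- exact: rescaled_vanishes.
- by move=> y; rewrite mulr_ge0// invr_ge0 ltW.
- rewrite [LHS]RintegralZl//; last exact: compactly_supported_integrable g0.
  by rewrite mulVf// gt_eqF.
Qed.

(** The averages against [shrinking_kernel] are smooth because derivatives can be
    put on the kernel, and their derivatives converge because, up to order two,
    they can be put on [F]. *)
Lemma smooth_periodic_approximation F : Zperiodic F -> Ck 2 F ->
  exists (phi : nat -> 'rV[R]_n -> R) (M : R),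
    [/\ forall m, Zperiodic (phi m) /\ Cinfty (phi m),
        forall m x, [/\ `|phi m x| <= M, forall i, `|partial i (phi m) x| <= M &
           forall i, `|partial i (partial i (phi m)) x| <= M] &
        forall x, [/\ phi m x @[m --> \oo] --> F x,
           forall i, partial i (phi m) x @[m --> \oo] --> partial i F x &
           forall i, partial i (partial i (phi m)) x @[m --> \oo] -->
             partial i (partial i F) x]].
Proof.
move=> pF CF.
have bounded (g : 'rV[R]_n -> R) : Zperiodic g -> continuous g ->
    exists M, forall x, `|g x| <= M.
  by move=> pg cg; have [M] := periodic_bounded pg cg; exists M.
have pF1 i : Zperiodic (partial i F) by exact: derive_periodic.
have pF2 i : Zperiodic (partial i (partial i F)) by exact: derive_periodic.
have cF := Ck_continuous CF.
have cF1 i : continuous (partial i F) by exact: Ck2_partial_continuous.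
have cF2 i : continuous (partial i (partial i F)).
  exact: Ck2_partial2_continuous.
have [M0 FM0] := bounded _ pF cF.
have /choice[M1 FM1] i := bounded _ (pF1 i) (cF1 i).
have /choice[M2 FM2] i := bounded _ (pF2 i) (cF2 i).
pose phi m := correlate (shrinking_kernel m) F.
have kK m := shrinking_kernel_averaging m.
have phi1 m i : partial i (phi m) = correlate (shrinking_kernel m) (partial i F).
  have [cK K0 _ _] := kK m; apply/funext => x.
  by have [] := correlate_derive cK K0 cF (Ck2_derivable CF) (FM1 i) x.
have phi2 m i : partial i (partial i (phi m)) =
    correlate (shrinking_kernel m) (partial i (partial i F)).
  have [cK K0 _ _] := kK m; rewrite phi1; apply/funext => x.
  by have [] := correlate_derive cK K0 (cF1 i) (Ck2_partial_derivable CF) (FM2 i) x.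
pose M := `|M0| + \sum_i `|M1 i| + \sum_i `|M2 i|.
have leM i : M1 i <= M /\ M2 i <= M.
  have s1 : `|M1 i| <= \sum_i `|M1 i| by rewrite (bigD1 i)//= lerDl sumr_ge0.
  have s2 : `|M2 i| <= \sum_i `|M2 i| by rewrite (bigD1 i)//= lerDl sumr_ge0.
  have := ler_norm (M1 i); have := ler_norm (M2 i); have := normr_ge0 M0.
  have := normr_ge0 (M1 i); have := normr_ge0 (M2 i).
  by rewrite /M; split; lra.
have leM0 : M0 <= M.
  rewrite /M -addrA (le_trans (ler_norm _))// lerDl.
  by rewrite addr_ge0// sumr_ge0.
have r0 : (fun m => m.+1%:R^-1 : R) @ \oo --> (0 : R) by exact: cvg_harmonic.
exists phi, M; split=> [m|m x|x].
- split; first exact: correlate_periodic.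
  move=> k; have [_ K0 _ _] := kK m.
  by apply: correlate_Ck K0 cF FM0; exact: shrinking_kernel_Cinfty.
- split=> [|i|i].
  + exact: le_trans (correlate_le x (kK m) cF FM0) leM0.
  + rewrite phi1; apply: (correlate_le _ (kK m)) => // y.
    by have [+ _] := leM i; apply: le_trans.
  + rewrite phi2; apply: (correlate_le _ (kK m)) => // y.
    by have [_] := leM i; apply: le_trans.
- split=> [|i|i].
  + exact: correlate_cvg r0 kK cF.
  + under eq_fun do rewrite phi1; exact: correlate_cvg r0 kK (cF1 i).
  + under eq_fun do rewrite phi2; exact: correlate_cvg r0 kK (cF2 i).
Qed.

End Mollifier.

(** * Convexity and the gradient in the momentum variable *)

Section Dot.
Context {R : realType} {n : nat}.
Implicit Types p q : 'rV[R]_n.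

Lemma dotDr p q1 q2 : dot p (q1 + q2) = dot p q1 + dot p q2.
Proof. by rewrite /dot -big_split; apply: eq_bigr => i _; rewrite mxE mulrDr. Qed.

Lemma dotZr p q (c : R) : dot p (c *: q) = c * dot p q.
Proof. by rewrite /dot mulr_sumr; apply: eq_bigr => i _; rewrite mxE mulrCA. Qed.

Lemma dotZl p q (c : R) : dot (c *: p) q = c * dot p q.
Proof. by rewrite /dot mulr_sumr; apply: eq_bigr => i _; rewrite mxE mulrA. Qed.

Lemma dot_delta p i : dot p (delta_mx 0 i) = p 0 i.
Proof.
rewrite /dot (bigD1 i)//= mxE !eqxx mulr1 big1 ?addr0// => j /negPf ji.
by rewrite mxE ji andbF mulr0.
Qed.

End Dot.

Section ConvexGradient.
Context {R : realType} {n : nat} (h : 'rV[R]_n -> R) (p : 'rV[R]_n).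
Hypothesis convex_h : convex_function [set: convex_lmodType 'rV[R]_n] h.

Lemma convex_functionP (l : R) (x y : 'rV[R]_n) : 0 <= l -> l <= 1 ->
  h (l *: x + (1 - l) *: y) <= l * h x + (1 - l) * h y.
Proof. by move=> l0 l1; apply: (convex_h (Itv01 l0 l1)); rewrite inE. Qed.

Hypothesis dh : forall i, derivable h p (delta_mx 0 i).

Let excess v := h (p + v) - h p - dot (grad h p) v.

Let excess_convex (l : R) v w : 0 <= l -> l <= 1 ->
  excess (l *: v + (1 - l) *: w) <= l * excess v + (1 - l) * excess w.
Proof.
move=> l0 l1; have := convex_functionP (p + v) (p + w) l0 l1.
rewrite !scalerDr addrACA -scalerDl [l + _]addrC subrK scale1r.
rewrite /excess dotDr !dotZr; lra.
Qed.

Let negligible_along v := forall e : R, 0 < e ->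
  exists2 d : R, 0 < d & forall t, 0 < t -> t < d -> excess (t *: v) <= e * t.

Let negligible_along_axis i (c : R) : negligible_along (c *: delta_mx 0 i).
Proof.
move=> e e0; have [c0|c0] := eqVneq c 0.
  exists 1 => // t t0 _; rewrite c0 scale0r scaler0 /excess addr0 subrr sub0r.
  by rewrite -[X in dot _ X](scale0r 0) dotZr mul0r oppr0 mulr_ge0// ltW.
have c1 : 0 < `|c| by rewrite normr_gt0.
have : (fun k : R => k^-1 *: ((h \o shift p) (k *: delta_mx 0 i) - h p)) @ 0^'
    --> partial i h p by exact: dh.
move=> /cvgrPdist_le/(_ (e / `|c|)); rewrite divr_gt0// => /(_ isT).
move=> /nbhs_ballP[d /= d0 hd].
exists (d / `|c|) => [|t t0 td]; first exact: divr_gt0.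
have tc0 : t * c != 0 by rewrite mulf_neq0// gt_eqF.
have /hd/(_ tc0) : ball (0 : R) d (t * c).
  by rewrite -ball_normE /= sub0r normrN normrM (gtr0_norm t0) -ltr_pdivlMr.
rewrite /= scalerA /excess dotZr dot_delta !mxE [_ + p]addrC.
set D := partial i h p; set Q := _ - h p => hQ.
have -> : Q - t * c * D = (t * c) * ((t * c)^-1 *: Q - D).
  by rewrite mulrBr mulrA divff// mul1r.
rewrite (le_trans (ler_norm _))// normrM normrM (gtr0_norm t0) distrC.
have -> : e * t = t * `|c| * (e / `|c|) by field; rewrite gt_eqF.
by rewrite ler_wpM2l// mulr_ge0// ltW.
Qed.

Let negligible_alongD v w : negligible_along v -> negligible_along w ->
  negligible_along (v + w).
Proof.
move=> nv nw e e0; have e20 : 0 < e / 2 by rewrite divr_gt0.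
have [d d0 dv] := nv _ e20; have [d' d'0 dw] := nw _ e20.
exists (Num.min d d' / 2) => [|t t0]; first by rewrite divr_gt0// lt_min d0.
rewrite ltr_pdivlMr// lt_min => /andP[td td'].
have t20 : 0 < t * 2 by rewrite mulr_gt0.
(* [t (v + w)] is the midpoint of [2 t v] and [2 t w]. *)
have := excess_convex ((t * 2) *: v) ((t * 2) *: w) (l := 1 / 2).
rewrite !scalerA (_ : 1 / 2 * (t * 2) = t); last by field.
rewrite (_ : (1 - 1 / 2) * (t * 2) = t); last by field.
rewrite -scalerDr; have := dv _ t20 td; have := dw _ t20 td'.
set a := excess _; set b := excess _; set c := excess _ => ha hb hc.
have := hc ltac:(lra) ltac:(lra); lra.
Qed.

Let negligible_along_all v : negligible_along v.
Proof.
rewrite (row_sum_delta v); elim/big_ind : _.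
- move=> e e0; exists 1 => // t t0 _; rewrite scaler0 /excess addr0 subrr sub0r.
  by rewrite -[X in dot _ X](scale0r 0) dotZr mul0r oppr0 mulr_ge0// ltW.
- exact: negligible_alongD.
- by move=> i _; exact: negligible_along_axis.
Qed.

(** The function [excess] is convex and vanishes at the origin.  Along each axis it
    is at most [o(t)] by differentiability; convexity propagates this bound to
    sums of directions, hence to every direction.  As the origin lies between
    [v] and [- t v], the value [excess v] is at least [- excess (- t v) / t],
    and the lower limit of this bound as [t] tends to zero is nonnegative. *)
Lemma convex_above_tangent q : h p + dot (grad h p) (q - p) <= h q.
Proof.
suff : 0 <= excess (q - p) by rewrite /excess [p + _]addrC subrK; lra.
set v := q - p; apply/ler_addgt0Pr => e e0.
have [d d0 dv] := negligible_along_all (- v) e0.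
pose t := d / 2; have t0 : 0 < t by rewrite divr_gt0.
have := dv t t0; rewrite /t => /(_ ltac:(lra)); rewrite -/t => vt.
have t1 : 0 < 1 + t by rewrite addr_gt0.
(* The weight [t / (1 + t)] is the one for which the origin is the barycentre of
   [v] and [- t v]. *)
have l0 : 0 <= t / (1 + t) by rewrite divr_ge0 ?ltW.
have l1 : t / (1 + t) <= 1 by rewrite ler_pdivrMr// mul1r lerDr.
have := excess_convex v (t *: - v) l0 l1.
have -> : t / (1 + t) *: v + (1 - t / (1 + t)) *: (t *: - v) = 0.
  rewrite scalerA scalerN -scalerBl (_ : _ - _ = 0) ?scale0r//.
  by field; rewrite gt_eqF.
have -> : excess 0 = 0.
  by rewrite /excess addr0 subrr sub0r -[X in dot _ X](scale0r 0) dotZr mul0r oppr0.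
have -> : 1 - t / (1 + t) = (1 + t)^-1 by field; rewrite gt_eqF.
rewrite mulrAC [X in _ + X]mulrC -mulrDl pmulr_lge0 ?invr_gt0// => ev.
have : 0 <= t * (excess v + e) by rewrite mulrDr (le_trans ev)// lerD2l mulrC.
by rewrite pmulr_rge0.
Qed.

End ConvexGradient.

Section HamiltonianGradient.
Context {R : realType} {n : nat}.

(** Regularity is assumed jointly in position and momentum, so a derivative in
    the momentum is read off as one of the last [n] partial derivatives of the
    joint function. *)
Lemma momentum_derive (H : 'rV[R]_n -> 'rV[R]_n -> R) x p i :
  Ck 2 (fun z : 'rV[R]_(n + n) => H (lsubmx z) (rsubmx z)) ->
  is_derive p (delta_mx 0 i) (H x)
    (partial (rshift n i) (fun z : 'rV[R]_(n + n) => H (lsubmx z) (rsubmx z))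
      (row_mx x p)).
Proof.
set G := fun z : 'rV[R]_(n + n) => _ => CG.
have dG : derivable G (row_mx x p) (delta_mx 0 (rshift n i)).
  exact: Ck2_derivable.
apply: derive_line.
have := @line_is_derive _ _ G (row_mx x p) (delta_mx 0 (rshift n i)) 0.
rewrite scale0r addr0 => /(_ dG); congr is_derive; apply/funext => s.
have -> : row_mx x p + s *: delta_mx 0 (rshift n i) =
    row_mx x (p + s *: delta_mx 0 i).
  apply/rowP => j; rewrite [LHS]mxE; case: (split_ordP j) => k ->.
    by rewrite !row_mxEl !mxE eq_lrshift andbF mulr0 addr0.
  by rewrite !row_mxEr !mxE eq_rshift.
by rewrite /G row_mxKl row_mxKr.
Qed.

Lemma momentum_gradient_continuous (H : 'rV[R]_n -> 'rV[R]_n -> R)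
    (v : 'rV[R]_n -> 'rV[R]_n) i :
  Ck 2 (fun z : 'rV[R]_(n + n) => H (lsubmx z) (rsubmx z)) ->
  (forall j, continuous (fun x => v x 0 j)) ->
  continuous (fun x => grad (H x) (v x) 0 i).
Proof.
move=> CG cv.
under eq_fun => x do
  (rewrite mxE /partial; have [_ ->] := momentum_derive x (v x) i CG).
have crow : continuous (fun x => row_mx x (v x)).
  apply: continuous_row => j; case: (split_ordP j) => k ->.
    by under eq_fun do rewrite row_mxEl; exact: coord_continuous.
  by under eq_fun do rewrite row_mxEr; exact: cv.
have cG : continuous (partial (rshift n i)
    (fun z : 'rV[R]_(n + n) => H (lsubmx z) (rsubmx z))).
  exact: Ck2_partial_continuous.
by move=> x; exact: (cvg_comp _ _ (crow x) (cG _)).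
Qed.

End HamiltonianGradient.

(** * Integration against an integrable weight on the torus *)

Section TorusWeight.
Context {R : realType} {n : nat} (theta : 'rV[R]_n -> R).
Hypothesis itheta : torus_integrable theta.
Local Notation mu := (@lebesgue_tuple R n).
Let mcube := @measurable_unit_cube R n.

Lemma unit_cube_norm (t : n.-tuple R) : unit_cube t -> `|row_of_tuple t| <= 1.
Proof.
move=> ct; apply: norm_le_coord => // i; rewrite row_of_tupleE.
by have /andP[t0 t1] := ct i; rewrite ger0_norm// ltW.
Qed.

Lemma torus_integrable_mul g : continuous g ->
  torus_integrable (fun x => theta x * g x).
Proof.
move=> cg; have [M _ gM] := continuous_bounded_ball cg 1.
apply: (integrableMl mcube itheta (h := g \o row_of_tuple)).
  by apply: measurable_funTS; exact: measurable_continuous_row.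
exists M; split; first exact: num_real.
move=> N MN t ct; apply: le_trans (ltW MN).
by apply: gM; exact: unit_cube_norm.
Qed.

Lemma torus_integral_mulD f g : continuous f -> continuous g ->
  torus_integral (fun x => theta x * (f x + g x)) =
  torus_integral (fun x => theta x * f x) + torus_integral (fun x => theta x * g x).
Proof.
move=> cf cg; rewrite -[RHS]RintegralD//; first last.
- exact: torus_integrable_mul cg.
- exact: torus_integrable_mul cf.
by apply: eq_Rintegral => t _; rewrite mulrDr.
Qed.

Lemma torus_integral_mulZ (c : R) f : continuous f ->
  torus_integral (fun x => theta x * (c * f x)) =
  c * torus_integral (fun x => theta x * f x).
Proof.
move=> cf; rewrite -[RHS]RintegralZl//; last exact: torus_integrable_mul cf.
by apply: eq_Rintegral => t _; rewrite mulrCA.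
Qed.

Lemma torus_integral_mul_cvg (g_ : nat -> 'rV[R]_n -> R) g B :
  (forall m, continuous (g_ m)) -> continuous B ->
  (forall m x, `|g_ m x| <= B x) ->
  (forall x, g_ m x @[m --> \oo] --> g x) ->
  torus_integral (fun x => theta x * g_ m x) @[m --> \oo] -->
    torus_integral (fun x => theta x * g x).
Proof.
move=> cg cB gB gg.
apply: (dominated_cvg_Rintegral mcube (g := fun t =>
  `|theta (row_of_tuple t) * B (row_of_tuple t)|)).
- move=> m; have /integrableP[+ _] := torus_integrable_mul (cg m).
  by move/measurable_EFinP.
- by move=> t _; apply: cvgM; [exact: cvg_cst|exact: gg].
- exact: integrable_norm (torus_integrable_mul cB).
- move=> m t _; rewrite !normrM ler_wpM2l//.
  by rewrite (le_trans (gB _ _))// ler_norm.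
Qed.

Hypothesis n_gt0 : (0 < n)%N.
Variable x0 : 'rV[R]_n.
Hypothesis theta_gt0 : forall x, ~ torus_eq x0 x -> 0 < theta x.

(** Congruent points have first coordinates that differ by an integer, so that
    coordinate ranges over a countable set; this is where [n > 0] enters. *)
Lemma torus_class_null : exists N : set (n.-tuple R),
  [/\ measurable N, mu N = 0%E &
      forall t, ~ N t -> ~ torus_eq x0 (row_of_tuple t)].
Proof.
case: n n_gt0 x0 => [//|n'] _ x1.
pose A := range (fun k : int => x1 0 ord0 + k%:~R).
have cA : countable A by exact: sub_countable (card_image_le _ _) _.
have mA : measurable A.
  by apply: countable_measurable => // r; exact: measurable_set1.
exists [set t | A (tnth t ord0)]; split.
- rewrite -[X in measurable X]setTI.
  exact: (measurable_tnth ord0 measurableT mA).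
- by apply: lebesgue_tuple_head_null => //; exact: countable_lebesgue_measure0.
- move=> t nAt [k tk]; apply: nAt; exists (k 0 ord0) => //.
  by rewrite -row_of_tupleE tk !mxE.
Qed.

(** The weight is nonnegative off a null set, which can be removed from the domain
    of both integrals. *)
Lemma le_torus_integral_mul f g : continuous f -> continuous g ->
  (forall x, f x <= g x) ->
  torus_integral (fun x => theta x * f x) <= torus_integral (fun x => theta x * g x).
Proof.
move=> cf cg fg; have [N [mN N0 Nth]] := torus_class_null.
have iF := torus_integrable_mul cf; have iG := torus_integrable_mul cg.
have mD : measurable (unit_cube `\` N) by exact: measurableD.
have offN h : continuous h -> torus_integral (fun x => theta x * h x) =
    \int[mu]_(t in unit_cube `\` N) (theta (row_of_tuple t) * h (row_of_tuple t)).
  move=> ch; congr fine; apply: negligible_integral => //.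
  exact: torus_integrable_mul ch.
rewrite !offN//; apply: le_Rintegral => //.
- by apply: (integrableS mcube) iF => //; exact: subDsetl.
- by apply: (integrableS mcube) iG => //; exact: subDsetl.
- by move=> t [_ /Nth tx]; rewrite ler_wpM2l// ltW// theta_gt0.
Qed.

End TorusWeight.

(** * The adjoint equation for test functions of class C^2 *)

Section Adjoint.
Context {R : realType} {n : nat}.
Variables (H : 'rV[R]_n -> 'rV[R]_n -> R) (a : 'rV[R]_n -> R) (eps eta : R).
Variables (x0 : 'rV[R]_n) (u theta : 'rV[R]_n -> R).

Implicit Types phi F gamma : 'rV[R]_n -> R.

Let drift x := grad (H x) (grad u x).

(** The operator whose formal adjoint appears in the equation of [theta]. *)
Definition linearized (phi : 'rV[R]_n -> R) (x : 'rV[R]_n) : R :=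
  eps * phi x + dot (drift x) (grad phi x)
  - (a x + eta ^+ 2) * laplacian phi x.

Hypothesis drift_continuous : forall i, continuous (fun x => drift x 0 i).
Hypothesis a_continuous : continuous a.

Let laplacian_continuous phi : Ck 2 phi -> continuous (laplacian phi).
Proof.
by move=> Cphi; apply: continuous_sumr => i; exact: Ck2_partial2_continuous.
Qed.

Let dot_continuous phi : Ck 2 phi ->
  continuous (fun x => dot (drift x) (grad phi x)).
Proof.
move=> Cphi; apply: continuous_sumr => i; apply: continuous_mul => //.
by under eq_fun do rewrite mxE; exact: Ck2_partial_continuous.
Qed.

Lemma linearized_continuous phi : Ck 2 phi -> continuous (linearized phi).
Proof.
move=> Cphi; apply: continuous_sub.
  apply: continuous_add; last exact: dot_continuous.
  exact: continuous_scale (Ck_continuous Cphi).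
apply: continuous_mul; last exact: laplacian_continuous.
by apply: continuous_add => //; exact: continuous_constant.
Qed.

Hypothesis itheta : torus_integrable theta.
Hypothesis adjoint : adjoint_equation H a eps eta x0 u theta.

(** A regrouping of the adjoint equation, in which all derivatives already fall on
    the test function. *)
Lemma adjoint_smooth phi : Zperiodic phi -> Cinfty phi ->
  torus_integral (fun x => theta x * linearized phi x) = eps * phi x0.
Proof.
move=> pphi Cphi; have := adjoint pphi Cphi.
have C2 := Cphi 2%N; have cphi := Ck_continuous C2.
have cep : continuous (fun x => eps * phi x) by exact: continuous_scale.
have cL := laplacian_continuous C2; have cD := dot_continuous C2.
have caL := continuous_mul a_continuous cL.
have -> : (fun x => a x * theta x * laplacian phi x) =
    (fun x => theta x * (a x * laplacian phi x)).
  by apply/funext => x; rewrite mulrA [a x * _]mulrC.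
have -> : (fun x => dot (theta x *: grad (H x) (grad u x)) (grad phi x)) =
    (fun x => theta x * dot (drift x) (grad phi x)).
  by apply/funext => x; rewrite dotZl.
have -> : linearized phi = (fun x => eps * phi x + (dot (drift x) (grad phi x) +
    (-1) * (a x * laplacian phi x + eta ^+ 2 * laplacian phi x))).
  by apply/funext => x; rewrite /linearized mulN1r -mulrDl addrA.
have ceL : continuous (fun x => eta ^+ 2 * laplacian phi x).
  exact: continuous_scale.
have cS : continuous (fun x => a x * laplacian phi x + eta ^+ 2 * laplacian phi x).
  exact: continuous_add.
have cNS : continuous (fun x =>
    -1 * (a x * laplacian phi x + eta ^+ 2 * laplacian phi x)).
  exact: continuous_scale.
have cT : continuous (fun x => dot (drift x) (grad phi x) +
    -1 * (a x * laplacian phi x + eta ^+ 2 * laplacian phi x)).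
  exact: continuous_add.
rewrite (torus_integral_mulD itheta cep cT).
rewrite (torus_integral_mulD itheta cD cNS) !torus_integral_mulZ//.
rewrite (torus_integral_mulD itheta caL ceL) torus_integral_mulZ//; lra.
Qed.

(** On the approximations the identity is [adjoint_smooth].  Their images under
    the linearized operator are dominated by the continuous function [B], so
    that the integrals converge, while the right-hand sides converge by
    convergence at [x0]. *)
Lemma adjoint_C2 gamma F : mollifier gamma -> Zperiodic F -> Ck 2 F ->
  torus_integral (fun x => theta x * linearized F x) = eps * F x0.
Proof.
move=> hgamma pF CF.
have [phi [M [phiC phiM phiF]]] := smooth_periodic_approximation hgamma pF CF.
pose B x := (`|eps| + \sum_i `|drift x 0 i| + (`|a x| + eta ^+ 2) * n%:R) * `|M|.
have cB : continuous B.
  apply: continuous_mul; last exact: continuous_constant.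
  apply: continuous_add.
    apply: continuous_add; first exact: continuous_constant.
    by apply: continuous_sumr => i; exact: continuous_abs.
  apply: continuous_mul; last exact: continuous_constant.
  by apply: continuous_add; [exact: continuous_abs|exact: continuous_constant].
have LB m x : `|linearized (phi m) x| <= B x.
  have [p0 p1 p2] := phiM m x.
  have leM (y : R) : `|y| <= M -> `|y| <= `|M| by move/le_trans; apply; exact: ler_norm.
  rewrite /linearized /B [leRHS]mulrDl [X in _ <= X + _]mulrDl.
  rewrite (le_trans (ler_normB _ _))// lerD//.
    rewrite (le_trans (ler_normD _ _))// lerD//.
      by rewrite normrM ler_wpM2l// leM.
    rewrite mulr_suml (le_trans (ler_norm_sum _ _ _))// ler_sum// => i _.
    by rewrite normrM ler_wpM2l// mxE leM.
  rewrite normrM -mulrA ler_pM//.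
    by rewrite (le_trans (ler_normD _ _))// lerD2l ger0_norm ?sqr_ge0.
  rewrite (le_trans (ler_norm_sum _ _ _))//.
  rewrite (@le_trans _ _ (\sum_(i < n) `|M|))//.
    by apply: ler_sum => i _; exact: leM.
  by rewrite sumr_const card_ord mulr_natl.
have Lcvg x : linearized (phi m) x @[m --> \oo] --> linearized F x.
  have [p0 p1 p2] := phiF x.
  apply: cvgB.
    apply: cvgD; first exact: cvgM (cvg_cst _) p0.
    apply: cvg_sumr => i; apply: cvgM; first exact: cvg_cst.
    by under eq_fun do rewrite mxE; rewrite mxE; exact: p1.
  by apply: cvgM; [exact: cvg_cst|apply: cvg_sumr => i; exact: p2].
have cL m : continuous (linearized (phi m)).
  by have [_ Cm] := phiC m; apply: linearized_continuous; exact: (Cm 2%N).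
have lim1 := torus_integral_mul_cvg itheta cL cB LB Lcvg.
have lim2 : eps * phi m x0 @[m --> \oo] --> eps * F x0.
  by have [p0 _ _] := phiF x0; exact: cvgM (cvg_cst _) p0.
apply: (cvg_unique _ lim1) => //.
rewrite (_ : (fun m => _) = (fun m => eps * phi m x0))//.
by apply/funext => m; have [pm Cm] := phiC m; exact: adjoint_smooth.
Qed.

End Adjoint.

(** The algebra of the pointwise estimate, with [d] the drift term, [h = eta^2]
    and [c = C eta]. *)
Lemma subtract_equation_le (R : realFieldType)
    (e W u hW hu d A h lW lu s c : R) :
  hu + d <= hW -> hW <= A * lW + s -> - c <= h * lW ->
  e * u + hu = (A + h) * lu ->
  e * (W - u) + d - (A + h) * (lW - lu) <= e * W + (s + c).
Proof. lra. Qed.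

Theorem lemma2p5 (R : realType) (n : nat) (n_gt0 : (0 < n)%N)
  (H : 'rV[R]_n -> 'rV[R]_n -> R) (a : 'rV[R]_n -> R)
  (hH : hamiltonian H) (ha : diffusion a)
  (gamma : 'rV[R]_n -> R) (hgamma : mollifier gamma)
  (w : 'rV[R]_n -> R) (hw : viscosity_solution H a w)
  (C : R) (C_gt0 : 0 < C) (S : R -> 'rV[R]_n -> R)
  (hCS : mollification_bounds H a (fun eta => mollify gamma eta w) C S)
  (eps eta : R) (eps_gt0 : 0 < eps) (eta_gt0 : 0 < eta)
  (x0 : 'rV[R]_n)
  (u : 'rV[R]_n -> R) (hu : discounted_solution H a eps eta u)
  (theta : 'rV[R]_n -> R)
  (htheta : adjoint_solution H a eps eta x0 u theta) :
  u x0 >= mollify gamma eta w x0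
          - torus_integral (fun x => mollify gamma eta w x * theta x)
          - C * eta / eps
          - eps^-1 * torus_integral (fun x => S eta x * theta x).
Proof.
have [[_ CH] convH _ _] := hH.
have [_ Ca _] := ha.
have [pw cw _ _] := hw.
have [Sreg _ _ Hw lapw] := hCS.
have [pu Cu equ] := hu.
have [[_ itheta] adj theta_gt0 theta1] := htheta.
have [_ cS] := Sreg _ eta_gt0.
have [M _ wM] := periodic_bounded pw cw.
set W := mollify gamma eta w.
have CW : Ck 2 W by exact: mollify_Cinfty wM 2%N.
have pW : Zperiodic W by exact: correlate_periodic.
have cW := Ck_continuous CW.
pose F x := W x - u x.
have CF : Ck 2 F by exact: Ck_sub.
have pF : Zperiodic F by move=> k x; rewrite /F pW pu.
have ca := Ck_continuous Ca.
have cgrad i : continuous (fun x => grad u x 0 i).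
  by under eq_fun do rewrite mxE; exact: Ck2_partial_continuous.
have cdrift i : continuous (fun x => grad (H x) (grad u x) 0 i).
  exact: momentum_gradient_continuous.
have partialF i : partial i F = (fun x => partial i W x - partial i u x).
  by apply/funext => x; apply: deriveB; exact: Ck2_derivable.
have gradF x : grad F x = grad W x - grad u x.
  by apply/rowP => i; rewrite !mxE partialF.
have lapF x : laplacian F x = laplacian W x - laplacian u x.
  rewrite /laplacian -sumrB; apply: eq_bigr => i _; rewrite partialF.
  by apply: deriveB; exact: Ck2_partial_derivable.
have LF x : linearized H a eps eta u F x <= eps * W x + (S eta x + C * eta).
  have dH i : derivable (H x) (grad u x) (delta_mx 0 i).
    by have [] := @momentum_derive _ _ H x (grad u x) i CH.
  have tangent := convex_above_tangent (convH x) dH (grad W x).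
  have := lapw eta x eta_gt0; rewrite ler_norml => /andP[lapW _].
  rewrite /linearized gradF lapF.
  exact: subtract_equation_le tangent (Hw eta x eta_gt0) lapW (equ x).
have cE : continuous (fun x => eps * W x).
  exact: continuous_scale.
have cC : continuous (fun _ : 'rV[R]_n => C * eta) by exact: continuous_constant.
have cSC : continuous (fun x => S eta x + C * eta).
  exact: continuous_add.
have cR : continuous (fun x => eps * W x + (S eta x + C * eta)).
  exact: continuous_add.
have := le_torus_integral_mul itheta n_gt0 theta_gt0
  (linearized_continuous cdrift ca CF) cR LF.
rewrite (adjoint_C2 cdrift ca itheta adj hgamma pF CF).
rewrite (torus_integral_mulD itheta cE cSC) (torus_integral_mulD itheta cS cC).
rewrite torus_integral_mulZ//.
have -> : torus_integral (fun x => theta x * (C * eta)) = C * eta.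
  have c1 : continuous (fun _ : 'rV[R]_n => 1 : R) by exact: continuous_constant.
  have := torus_integral_mulZ itheta (C * eta) c1.
  under eq_fun do rewrite mulr1; under [in RHS]eq_fun do rewrite mulr1.
  by rewrite theta1 mulr1.
have -> : (fun x => W x * theta x) = (fun x => theta x * W x).
  by apply/funext => x; rewrite mulrC.
have -> : (fun x => S eta x * theta x) = (fun x => theta x * S eta x).
  by apply/funext => x; rewrite mulrC.
set I1 := torus_integral _; set I2 := torus_integral _; rewrite /F => main.
have -> : W x0 - I1 - C * eta / eps - eps^-1 * I2 =
    W x0 - (eps * I1 + (I2 + C * eta)) / eps by field; rewrite gt_eqF.
have : W x0 - u x0 <= (eps * I1 + (I2 + C * eta)) / eps.
  by rewrite ler_pdivlMr// mulrC.
lra.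
Qed.
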